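(* For every order $r\in\{1,2,3,\ldots\}$, on the random model $(\Omega_n,P_n)$ the $r$th bifurcation ratio satisfies \[ \sqrt{n}\left(\frac{S_{r+1,n}}{S_{r,n}}-\frac{1}{4}\right)\Rightarrow N\left(0,\,4^{r-3}\right)\qquad (n\to\infty), \] where $\Rightarrow$ denotes convergence in distribution and $N(\mu,\sigma^2)$ is the normal distribution with mean $\mu$ and variance $\sigma^2$.
   Context: For $n\ge 1$, let $\Omega_n$ be the set of rooted plane (ordered) full binary trees with $n$ leaves (every internal node has exactly two children, left and right distinguished), so $|\Omega_n|=\frac{(2n-2)!}{n!(n-1)!}$. The random model is $\Omega_n$ with the uniform probability measure $P_n$. Horton–Strahler ordering: every leaf has order 1; an internal node whose two children have different orders $r_1\neq r_2$ has order $\max\{r_1,r_2\}$; an internal node whose two children both have order $r$ has order $r+1$. A branch of order $r$ is a maximal connected path consisting of nodes all of order $r$. For $\tau\in\Omega_n$, $S_{r,n}(\tau)$ denotes the number of branches of order $r$ in $\tau$ (so $S_{1,n}=n$). The $r$th bifurcation ratio is the random variable $S_{r+1,n}/S_{r,n}$, with the convention that it equals $0$ when $S_{r,n}=0$. *)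

(* Defs.v *)
From Stdlib Require Import Reals Lra Lia List Arith ZArith.
From Coquelicot Require Import Coquelicot.
Import ListNotations.
Open Scope R_scope.

Inductive tree : Type :=
  | Leaf : tree
  | Node : tree -> tree -> tree.

Fixpoint leaves (t : tree) : nat :=
  match t with
  | Leaf => 1%nat
  | Node l r => (leaves l + leaves r)%nat
  end.

(** Enumeration of all trees with exactly n leaves (fuel-based recursion;
    [trees_fuel f n] is correct whenever f >= n). *)
Fixpoint trees_fuel (fuel n : nat) : list tree :=
  match fuel with
  | O => []
  | S f =>
      match n with
      | O => []
      | S O => [Leaf]
      | _ =>
          flat_map (fun k =>
            flat_map (fun l => map (fun r => Node l r) (trees_fuel f (n - k)))
                     (trees_fuel f k))
            (seq 1 (n - 1))
      end
  end.

Definition Omega (n : nat) : list tree := trees_fuel n n.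

Fixpoint hs_order (t : tree) : nat :=
  match t with
  | Leaf => 1%nat
  | Node l r =>
      let a := hs_order l in
      let b := hs_order r in
      if Nat.eqb a b then S a else Nat.max a b
  end.

(** Number of branches of order k: a branch (maximal path of nodes of order k)
    is counted via its top node, i.e. a node of order k which is the root or
    whose parent has order different from k. [po] is the order of the parent
    (None for the root). *)
Fixpoint branch_tops (k : nat) (po : option nat) (t : tree) : nat :=
  let o := hs_order t in
  let here :=
    if Nat.eqb o k then
      match po with
      | None => 1%nat
      | Some p => if Nat.eqb p k then 0%nat else 1%nat
      end
    else 0%nat in
  match t with
  | Leaf => here
  | Node l r => (here + branch_tops k (Some o) l + branch_tops k (Some o) r)%nat
  end.

Definition S_branches (k : nat) (t : tree) : nat := branch_tops k None t.

Definition bif_ratio (r : nat) (t : tree) : R :=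
  if Nat.eqb (S_branches r t) 0 then 0
  else INR (S_branches (S r) t) / INR (S_branches r t).

Definition Pn (n : nat) (A : tree -> bool) : R :=
  INR (length (filter A (Omega n))) / INR (length (Omega n)).

Definition normal_density (mu s2 : R) (y : R) : R :=
  exp (- (y - mu) ^ 2 / (2 * s2)) / sqrt (2 * PI * s2).

Definition normal_cdf (mu s2 : R) (x : R) : R :=
  RInt_gen (normal_density mu s2) (Rbar_locally m_infty) (at_point x).

Definition stat (r n : nat) (t : tree) : R :=
  sqrt (INR n) * (bif_ratio r t - 1 / 4).

Definition le_event (r n : nat) (x : R) (t : tree) : bool :=
  if Rle_dec (stat r n t) x then true else false.

Example omega_sizes : map (fun n => length (Omega n)) [1;2;3;4;5;6]%nat = [1;1;2;5;14;42]%nat.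
Proof. reflexivity. Qed.
Example S1_is_n : map (fun t => S_branches 1 t) (Omega 5) = repeat 5%nat 14.
Proof. reflexivity. Qed.

(* Main.v *)
(** Pruning a tree (deleting its leaves and contracting the vertices left with a single
    child) lowers every Horton-Strahler order by one, so that [S_(r+1)] of a tree is [S_r]
    of the pruned tree. The number of trees with [n] leaves that are pruned to a given tree
    with [m] leaves depends only on [n] and [m]: it is the coefficient of [z^n] in
    [z^(2m) / (1 - 2z)^(2m-1)]. Hence, given its number [m] of leaves, the pruned tree is
    again uniform. Together with the recurrence of the Catalan numbers this shows that the
    law [p] of [S_2] satisfies [4 m (m+1) p (m+1) = (n - 2m) (n - 2m - 1) p m].

    Summing this recurrence against [m - n/4] bounds the variance of [S_2] by [n]; comparing
    it with the ratios of the density of [N(0, 1/16)] on the window [|m - n/4| <= K sqrt n]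
    gives the central limit theorem for [r = 1]. For larger [r], conditioning on the pruned
    tree expresses the law of the [(r+1)]st ratio on [n] leaves as a mixture over [m] of the
    laws of the [r]th ratio rescaled by [sqrt (m / n)], and [m / n] concentrates at [1/4]:
    each step multiplies the limiting variance by [4]. *)

Require Import Defs.
From Stdlib Require Import Reals ZArith Lra Lia List Arith FunctionalExtensionality.
From Coquelicot Require Import Coquelicot.
Import ListNotations.
Open Scope R_scope.

(** * Finite sums over lists and initial segments *)

Fixpoint lsum {A : Type} (f : A -> R) (l : list A) : R :=
  match l with
  | [] => 0
  | a :: l' => f a + lsum f l'
  end.

Lemma lsum_app {A} (f : A -> R) l1 l2 : lsum f (l1 ++ l2) = lsum f l1 + lsum f l2.
Proof. induction l1 as [|a l IH]; simpl; lra. Qed.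

Lemma lsum_ext_in {A} (f g : A -> R) l :
  (forall a, In a l -> f a = g a) -> lsum f l = lsum g l.
Proof.
  induction l as [|a l IH]; simpl; intros H; [easy|].
  rewrite (H a) by auto. rewrite IH by auto. easy.
Qed.

Lemma lsum_le_in {A} (f g : A -> R) l :
  (forall a, In a l -> f a <= g a) -> lsum f l <= lsum g l.
Proof.
  induction l as [|a l IH]; simpl; intros H; [lra|].
  apply Rplus_le_compat; auto.
Qed.

Lemma lsum_plus {A} (f g : A -> R) l : lsum (fun a => f a + g a) l = lsum f l + lsum g l.
Proof. induction l as [|a l IH]; simpl; lra. Qed.

Lemma lsum_scal {A} c (f : A -> R) l : lsum (fun a => c * f a) l = c * lsum f l.
Proof. induction l as [|a l IH]; simpl; [|rewrite IH]; ring. Qed.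

Lemma lsum_const {A} c (l : list A) : lsum (fun _ => c) l = c * INR (length l).
Proof.
  induction l as [|a l IH]; [simpl; ring|].
  cbn [length lsum]. rewrite IH, S_INR. ring.
Qed.

Lemma lsum_map {A B} (h : A -> B) (f : B -> R) l : lsum f (map h l) = lsum (fun a => f (h a)) l.
Proof. induction l as [|a l IH]; simpl; congruence. Qed.

Lemma lsum_flat_map {A B} (h : A -> list B) (f : B -> R) l :
  lsum f (flat_map h l) = lsum (fun a => lsum f (h a)) l.
Proof. induction l as [|a l IH]; simpl; [easy|]. rewrite lsum_app. congruence. Qed.

Lemma lsum_swap {A B} (f : A -> B -> R) l1 l2 :
  lsum (fun a => lsum (f a) l2) l1 = lsum (fun b => lsum (fun a => f a b) l1) l2.
Proof.
  induction l1 as [|a l IH]; simpl.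
  - rewrite lsum_const. ring.
  - rewrite IH, lsum_plus. easy.
Qed.

Lemma lsum_filter {A} (p : A -> bool) l :
  INR (length (filter p l)) = lsum (fun a => if p a then 1 else 0) l.
Proof.
  induction l as [|a l IH]; [easy|]. cbn [filter lsum].
  destruct (p a); [cbn [length]; rewrite S_INR|]; lra.
Qed.

Definition psum (f : nat -> R) (k : nat) : R := lsum f (seq 0 k).

Lemma psum_S f k : psum f (S k) = psum f k + f k.
Proof. unfold psum. rewrite seq_S, lsum_app. simpl. lra. Qed.

Lemma psum_S_first f k : psum f (S k) = f 0%nat + psum (fun i => f (S i)) k.
Proof. unfold psum. simpl. now rewrite <- seq_shift, lsum_map. Qed.

Lemma psum_single f k j :
  (j < k)%nat -> (forall i, (i < k)%nat -> i <> j -> f i = 0) -> psum f k = f j.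
Proof.
  induction k as [|k IH]; [lia|]. intros Hj H. rewrite psum_S.
  destruct (Nat.eq_dec j k) as [->|Hn].
  - unfold psum. rewrite (lsum_ext_in _ (fun _ => 0)), lsum_const; [ring|].
    intros i Hi. apply in_seq in Hi. apply H; lia.
  - rewrite IH, (H k) by (try lia; intros; apply H; lia). ring.
Qed.

(** * Formal power series *)

Notation fps := (nat -> R).

(* The Cauchy product, by recursion on the degree: with [f = f 0 + z * tail f],
   every ring law below is a direct induction. *)
Fixpoint conv (f g : fps) (n : nat) : R :=
  match n with
  | O => f O * g O
  | S n' => f O * g (S n') + conv (fun k => f (S k)) g n'
  end.

Lemma conv_S f g n : conv f g (S n) = f O * g (S n) + conv (fun k => f (S k)) g n.
Proof. easy. Qed.

Definition fadd (f g : fps) : fps := fun n => f n + g n.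
Definition fopp (f : fps) : fps := fun n => - f n.
Definition fsub (f g : fps) : fps := fun n => f n - g n.
Definition cst (a : R) : fps := fun n => match n with O => a | _ => 0 end.
Definition Z1 : fps := fun n => match n with S O => 1 | _ => 0 end.

Lemma conv_add_l f g h n : conv (fadd f g) h n = conv f h n + conv g h n.
Proof.
  revert f g; induction n as [|n IH]; intros f g; simpl; unfold fadd at 1; [ring|].
  change (fun k => fadd f g (S k)) with (fadd (fun k => f (S k)) (fun k => g (S k))).
  rewrite IH. ring.
Qed.

Lemma conv_scal_l a f g n : conv (fun k => a * f k) g n = a * conv f g n.
Proof.
  revert f; induction n as [|n IH]; intros f; simpl; [ring|].
  rewrite (IH (fun k => f (S k))). ring.
Qed.

Lemma conv_zero_l g n : conv (fun _ => 0) g n = 0.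
Proof. induction n as [|n IH]; simpl; [|rewrite IH]; ring. Qed.

Lemma conv_last f g n : conv f g (S n) = conv f (fun k => g (S k)) n + f (S n) * g O.
Proof.
  revert f; induction n as [|n IH]; intros f; [simpl; ring|].
  change (conv f g (S (S n))) with (f O * g (S (S n)) + conv (fun k => f (S k)) g (S n)).
  rewrite IH. simpl. ring.
Qed.

Lemma conv_comm f g : conv f g = conv g f.
Proof.
  apply functional_extensionality; intros n.
  revert f g; induction n as [|n IH]; intros f g; [simpl; ring|].
  rewrite conv_last. simpl. rewrite IH. ring.
Qed.

Lemma conv_assoc_at f g h n : conv f (conv g h) n = conv (conv f g) h n.
Proof.
  revert f; induction n as [|n IH]; intros f; [simpl; ring|].
  rewrite !conv_S, IH.
  change (fun k => conv f g (S k))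
    with (fadd (fun k => f O * g (S k)) (conv (fun k => f (S k)) g)).
  rewrite conv_add_l, (conv_scal_l (f O) (fun k => g (S k))). simpl. ring.
Qed.

Lemma conv_cst a f n : conv (cst a) f n = a * f n.
Proof.
  destruct n as [|n]; simpl; [easy|].
  rewrite (conv_zero_l f n). ring.
Qed.

(** Registering this structure lets [ring] close identities between generating functions, with
    Leibniz equality obtained from functional extensionality. *)
Lemma fps_ring : ring_theory (cst 0) (cst 1) fadd conv fsub fopp eq.
Proof.
  constructor; intros; try (apply functional_extensionality; intros n).
  - destruct n; unfold fadd; simpl; ring.
  - unfold fadd; ring.
  - unfold fadd; ring.
  - rewrite conv_cst. ring.
  - now rewrite conv_comm.
  - apply conv_assoc_at.
  - apply conv_add_l.
  - easy.
  - destruct n; unfold fadd, fopp; simpl; ring.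
Qed.

Add Ring fps_ring : fps_ring.

Lemma cst_add a b : cst (a + b) = fadd (cst a) (cst b).
Proof.
  apply functional_extensionality; intros [|n]; unfold fadd; simpl; ring.
Qed.

Lemma conv_Z1_0 f : conv Z1 f 0 = 0.
Proof. simpl. ring. Qed.

Lemma conv_Z1_S f n : conv Z1 f (S n) = f n.
Proof.
  cbn [conv]. replace (fun k => Z1 (S k)) with (cst 1).
  - rewrite conv_cst. simpl. ring.
  - apply functional_extensionality; intros [|k]; easy.
Qed.

Lemma conv_nonneg f g n :
  (forall k, 0 <= f k) -> (forall k, 0 <= g k) -> 0 <= conv f g n.
Proof.
  intros Hf Hg; revert f Hf; induction n as [|n IH]; intros f Hf; simpl.
  - now apply Rmult_le_pos.
  - apply Rplus_le_le_0_compat; [now apply Rmult_le_pos|auto].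
Qed.

Lemma conv_psum f g n : conv f g n = psum (fun k => f k * g (n - k)%nat) (S n).
Proof.
  revert f; induction n as [|n IH]; intros f.
  - unfold psum; simpl; ring.
  - rewrite psum_S_first. cbn [conv]. rewrite IH. easy.
Qed.

(* [z d/dz] *)
Definition theta (f : fps) : fps := fun n => INR n * f n.

Lemma theta_conv f g : theta (conv f g) = fadd (conv (theta f) g) (conv f (theta g)).
Proof.
  apply functional_extensionality; intros n. unfold fadd.
  revert f; induction n as [|n IH]; intros f.
  - unfold theta; simpl; ring.
  - specialize (IH (fun k => f (S k))). unfold theta at 1. cbn [conv].
    (* The shift lowers the degree by one, so [theta] of the tail falls short of the tail of
       [theta f] by one copy of the tail. *)
    replace (fun k => theta f (S k))
      with (fadd (theta (fun k => f (S k))) (fun k => f (S k))).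
    2:{ apply functional_extensionality; intros k. unfold fadd, theta.
        rewrite S_INR; ring. }
    rewrite conv_add_l. unfold theta in IH at 1. unfold theta at 1 3.
    rewrite S_INR. simpl INR at 2. simpl INR in *. lra.
Qed.

Lemma theta_add f g : theta (fadd f g) = fadd (theta f) (theta g).
Proof. apply functional_extensionality; intros n; unfold theta, fadd; ring. Qed.

Lemma theta_cst a : theta (cst a) = cst 0.
Proof. apply functional_extensionality; intros [|n]; unfold theta; simpl; ring. Qed.

Lemma theta_Z1 : theta Z1 = Z1.
Proof.
  apply functional_extensionality; intros [|[|n]]; unfold theta; simpl; ring.
Qed.

(* [1 / (1 - 2 z)] *)
Definition geom2 : fps := fun n => 2 ^ n.

Lemma geom2_eq : geom2 = fadd (cst 1) (fadd (conv Z1 geom2) (conv Z1 geom2)).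
Proof.
  apply functional_extensionality; intros [|n]; unfold fadd.
  - unfold geom2; simpl; ring.
  - rewrite conv_Z1_S. unfold geom2; simpl; ring.
Qed.

(** Solves $f = g + 2zf$ without inverses: $f/(1-2z)$ is expanded once with the equation of $f$ and
    once with that of [geom2], and the common term cancels. *)
Lemma geom2_div f g : f = fadd g (fadd (conv Z1 f) (conv Z1 f)) -> f = conv geom2 g.
Proof.
  intros H.
  assert (E : conv geom2 f = fadd (conv geom2 g)
                (conv geom2 (fadd (conv Z1 f) (conv Z1 f)))).
  { rewrite H at 1. ring. }
  assert (E2 : conv geom2 f = fadd f (conv geom2 (fadd (conv Z1 f) (conv Z1 f)))).
  { rewrite geom2_eq at 1. ring. }
  apply functional_extensionality; intros n.
  apply (f_equal (fun h => h n)) in E, E2. unfold fadd in E at 1, E2 at 1. lra.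
Qed.

Lemma theta_geom2 : theta geom2 = conv (fadd Z1 Z1) (conv geom2 geom2).
Proof.
  transitivity (conv geom2 (conv (fadd Z1 Z1) geom2)); [|ring].
  apply geom2_div.
  rewrite geom2_eq at 1. rewrite !theta_add, !theta_conv, theta_Z1, theta_cst. ring.
Qed.

(** * Sums over the trees with a given number of leaves *)

Lemma flat_map_ext_in {A B} (f g : A -> list B) l :
  (forall a, In a l -> f a = g a) -> flat_map f l = flat_map g l.
Proof.
  induction l as [|a l IH]; simpl; intros H; [easy|].
  rewrite (H a) by auto. rewrite IH by auto. easy.
Qed.

Lemma trees_fuel_rec f n : trees_fuel (S f) (S (S n)) =
  flat_map (fun k => flat_map (fun l =>
    map (fun r => Node l r) (trees_fuel f (S (S n) - k))) (trees_fuel f k)) (seq 1 (S n)).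
Proof. easy. Qed.

Lemma trees_fuel_enough f n : (n <= f)%nat -> trees_fuel f n = Omega n.
Proof.
  unfold Omega. revert n.
  induction f as [f IH] using (well_founded_induction lt_wf). intros n Hn.
  destruct n as [|n]; [destruct f; easy|].
  destruct f as [|f]; [lia|].
  destruct n as [|n]; [easy|].
  rewrite !trees_fuel_rec. apply flat_map_ext_in. intros k Hk. apply in_seq in Hk.
  destruct (Nat.eq_dec f (S n)) as [->|Hne]; [easy|].
  rewrite !(IH f), !(IH (S n)) by lia. easy.
Qed.

Lemma Omega_rec n : (2 <= n)%nat ->
  Omega n = flat_map (fun k =>
    flat_map (fun l => map (fun r => Node l r) (Omega (n - k))) (Omega k)) (seq 1 (n - 1)).
Proof.
  intros Hn. destruct n as [|[|n]]; [lia|lia|]. unfold Omega at 1. rewrite trees_fuel_rec.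
  apply flat_map_ext_in. intros k Hk. apply in_seq in Hk.
  rewrite !trees_fuel_enough by lia. easy.
Qed.

Definition tsum (f : tree -> R) : fps := fun n => lsum f (Omega n).

Lemma tsum_0 f : tsum f 0 = 0.
Proof. easy. Qed.

Lemma tsum_1 f : tsum f 1 = f Leaf.
Proof. unfold tsum; simpl; ring. Qed.

(** Cutting at the root turns a product over the two subtrees into a Cauchy product; its two extreme
    terms vanish because [Omega 0] is empty. *)
Lemma tsum_node (f f1 f2 : tree -> R) n :
  (forall l r, f (Node l r) = f1 l * f2 r) -> (2 <= n)%nat ->
  tsum f n = conv (tsum f1) (tsum f2) n.
Proof.
  intros Hf Hn. rewrite conv_psum, psum_S, Nat.sub_diag, tsum_0.
  destruct n as [|n]; [lia|]. rewrite psum_S_first, tsum_0.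
  unfold tsum at 1. rewrite Omega_rec, lsum_flat_map, <- seq_shift, lsum_map by easy.
  unfold psum. replace (S n - 1)%nat with n by lia.
  rewrite Rmult_0_l, Rmult_0_r, Rplus_0_l, Rplus_0_r.
  apply lsum_ext_in; intros k _. rewrite lsum_flat_map. unfold tsum.
  rewrite (lsum_ext_in _ (fun l => lsum f2 (Omega (S n - S k)) * f1 l)).
  { rewrite lsum_scal. ring. }
  intros l _. rewrite lsum_map.
  rewrite (lsum_ext_in _ (fun r => f1 l * f2 r)) by auto.
  rewrite lsum_scal. ring.
Qed.

Lemma tsum_split (f f1 f2 : tree -> R) :
  (forall l r, f (Node l r) = f1 l * f2 r) ->
  tsum f = fadd (conv (cst (f Leaf)) Z1) (conv (tsum f1) (tsum f2)).
Proof.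
  intros Hf. apply functional_extensionality; intros n. unfold fadd.
  rewrite conv_cst.
  destruct n as [|[|n]].
  - simpl. rewrite !tsum_0. ring.
  - cbn [conv]. rewrite !tsum_1, !tsum_0. simpl. ring.
  - rewrite <- (tsum_node f) by (auto; lia). simpl. ring.
Qed.

Lemma tsum_plus f g : tsum (fun t => f t + g t) = fadd (tsum f) (tsum g).
Proof. apply functional_extensionality; intros n. apply lsum_plus. Qed.

Lemma tsum_ext f g : (forall t, f t = g t) -> tsum f = tsum g.
Proof.
  intros H. apply functional_extensionality; intros n.
  apply lsum_ext_in; auto.
Qed.

(** * Each tree occurs exactly once in the enumeration *)

Definition tree_eq_dec (s t : tree) : {s = t} + {s <> t}.
Proof. decide equality. Defined.

Definition ind_tree (s t : tree) : R := if tree_eq_dec t s then 1 else 0.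

Lemma ind_tree_node a b l r : ind_tree (Node a b) (Node l r) = ind_tree a l * ind_tree b r.
Proof.
  unfold ind_tree.
  destruct (tree_eq_dec (Node l r) (Node a b)), (tree_eq_dec l a), (tree_eq_dec r b);
    try ring; congruence.
Qed.

Fixpoint fpow (f : fps) (n : nat) : fps :=
  match n with O => cst 1 | S n' => conv f (fpow f n') end.

Lemma fpow_add f m n : fpow f (m + n) = conv (fpow f m) (fpow f n).
Proof. induction m as [|m IH]; simpl; [|rewrite IH]; ring. Qed.

Lemma fpow_Z1 k n : fpow Z1 k n = if Nat.eq_dec n k then 1 else 0.
Proof.
  revert n; induction k as [|k IH]; intros n.
  - destruct n; simpl; easy.
  - cbn [fpow]. destruct n as [|n].
    + rewrite conv_Z1_0. easy.
    + rewrite conv_Z1_S, IH.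
      destruct (Nat.eq_dec n k), (Nat.eq_dec (S n) (S k)); lia || easy.
Qed.

Lemma tsum_ind_leaf : tsum (ind_tree Leaf) = Z1.
Proof.
  rewrite (tsum_split (ind_tree Leaf) (fun _ => 0) (fun _ => 0)).
  - apply functional_extensionality; intros n. unfold fadd. rewrite conv_cst.
    replace (tsum (fun _ => 0)) with (cst 0).
    + rewrite conv_cst. unfold ind_tree. destruct (tree_eq_dec Leaf Leaf); [ring|easy].
    + apply functional_extensionality; intros k. unfold tsum. rewrite lsum_const.
      destruct k; simpl; ring.
  - intros l r. unfold ind_tree. destruct (tree_eq_dec _ _); [easy|ring].
Qed.

(** Read on coefficients: [s] occurs exactly once in [Omega (leaves s)] and in no other [Omega n].
    Completeness and absence of repetitions both come out of the root decomposition. *)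
Lemma tsum_ind_tree s : tsum (ind_tree s) = fpow Z1 (leaves s).
Proof.
  induction s as [|a IHa b IHb].
  - rewrite tsum_ind_leaf. simpl. ring.
  - rewrite (tsum_split _ (ind_tree a) (ind_tree b)) by apply ind_tree_node.
    rewrite IHa, IHb. cbn [leaves]. rewrite fpow_add.
    unfold ind_tree. destruct (tree_eq_dec Leaf (Node a b)); [easy|]. ring.
Qed.

(** Writes a value at one tree as a sum over all small trees, so that in [sum_prune] the sums over
    trees and over pruned trees can be exchanged. *)
Lemma sum_ind_tree n s (g : tree -> R) : (leaves s <= n)%nat ->
  psum (fun m => lsum (fun t => ind_tree t s * g t) (Omega m)) (S n) = g s.
Proof.
  intros Hs. rewrite (psum_single _ _ (leaves s)).
  - rewrite (lsum_ext_in _ (fun t => g s * ind_tree s t)).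
    + rewrite lsum_scal. fold (tsum (ind_tree s) (leaves s)).
      rewrite tsum_ind_tree, fpow_Z1. destruct (Nat.eq_dec _ _); [ring|lia].
    + intros t _. unfold ind_tree.
      destruct (tree_eq_dec s t), (tree_eq_dec t s); subst; try ring; congruence.
  - lia.
  - intros m Hm Hne.
    rewrite (lsum_ext_in _ (fun t => g s * ind_tree s t)).
    + rewrite lsum_scal. fold (tsum (ind_tree s) m).
      rewrite tsum_ind_tree, fpow_Z1. destruct (Nat.eq_dec _ _); [lia|ring].
    + intros t _. unfold ind_tree.
      destruct (tree_eq_dec s t), (tree_eq_dec t s); subst; try ring; congruence.
Qed.

(** * Catalan numbers *)

(* Indexed by leaves: [catalan n] is the Catalan number of index [n - 1], and [catalan 0 = 0]. *)
Definition catalan : fps := tsum (fun _ => 1).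

Lemma catalan_length n : catalan n = INR (length (Omega n)).
Proof. unfold catalan, tsum. rewrite lsum_const. ring. Qed.

Lemma catalan_eq : catalan = fadd Z1 (conv catalan catalan).
Proof.
  unfold catalan at 1. rewrite (tsum_split _ (fun _ => 1) (fun _ => 1)) by (intros; ring).
  fold catalan. ring.
Qed.

(* With [C = z + C^2], both [(1 - 2 C)^2 = 1 - 4 z] and [(1 - 2 C) theta C = z]. *)
Lemma catalan_ode :
  fsub (theta catalan) (conv (fadd (fadd Z1 Z1) (fadd Z1 Z1)) (theta catalan))
  = fsub Z1 (conv (fadd Z1 Z1) catalan).
Proof.
  set (D := fsub (cst 1) (fadd catalan catalan)).
  assert (H1 : conv D (theta catalan) = Z1).
  { assert (E : theta catalan = fadd Z1 (fadd (conv catalan (theta catalan)) (conv catalan (theta catalan)))).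
    { rewrite catalan_eq at 1. rewrite theta_add, theta_Z1, theta_conv. ring. }
    transitivity (fsub (theta catalan) (fadd (conv catalan (theta catalan)) (conv catalan (theta catalan)))).
    - unfold D; ring.
    - rewrite E at 1. ring. }
  assert (E1 : Z1 = fsub catalan (conv catalan catalan)) by (rewrite catalan_eq at 1; ring).
  transitivity (conv D (conv D (theta catalan))).
  - unfold D. rewrite E1. ring.
  - rewrite H1. unfold D. ring.
Qed.

(** This is the coefficient of $z^{m+1}$ in [catalan_ode]; for $m \ge 1$ the term [Z1] does not
    reach that degree. *)
Lemma catalan_rec m : (1 <= m)%nat ->
  INR (S m) * catalan (S m) = 2 * (2 * INR m - 1) * catalan m.
Proof.
  intros Hm. pose proof (f_equal (fun f => f (S m)) catalan_ode) as H.
  unfold fsub in H.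
  assert (E : forall f, conv (fadd Z1 Z1) f (S m) = 2 * f m).
  { intros f. rewrite conv_add_l, conv_Z1_S. ring. }
  rewrite E, conv_add_l, E in H. unfold theta in H.
  destruct m as [|m]; [lia|]. simpl Z1 in H. lra.
Qed.

Lemma catalan_1 : catalan 1 = 1.
Proof. unfold catalan; now rewrite tsum_1. Qed.

Lemma catalan_pos n : (1 <= n)%nat -> 0 < catalan n.
Proof.
  induction n as [|n IH]; [lia|]. intros _. destruct n as [|n].
  - rewrite catalan_1. lra.
  - pose proof (catalan_rec (S n) ltac:(lia)) as H.
    specialize (IH ltac:(lia)).
    assert (0 < INR (S (S n))) by (apply lt_0_INR; lia).
    assert (1 <= INR (S n)) by (apply (le_INR 1); lia).
    apply (Rmult_lt_reg_l (INR (S (S n)))); [easy|]. rewrite H, Rmult_0_r.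
    apply Rmult_lt_0_compat; [lra|easy].
Qed.

(** * Pruning *)

Fixpoint prune (t : tree) : option tree :=
  match t with
  | Leaf => None
  | Node l r =>
      match prune l, prune r with
      | None, None => Some Leaf
      | Some a, None => Some a
      | None, Some b => Some b
      | Some a, Some b => Some (Node a b)
      end
  end.

Lemma prune_none t : prune t = None -> t = Leaf.
Proof. destruct t; simpl; [easy|]. now destruct (prune t1), (prune t2). Qed.

Lemma leaves_pos t : (1 <= leaves t)%nat.
Proof. induction t; simpl; lia. Qed.

Lemma prune_leaves t s : prune t = Some s -> (2 * leaves s <= leaves t)%nat.
Proof.
  revert s; induction t as [|l IHl r IHr]; simpl; [easy|]. intros s.
  pose proof (leaves_pos l). pose proof (leaves_pos r).
  destruct (prune l) as [a|], (prune r) as [b|]; intros E; injection E as <-;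
    try specialize (IHl _ eq_refl); try specialize (IHr _ eq_refl); simpl; lia.
Qed.

Lemma Omega_leaves n t : In t (Omega n) -> leaves t = n.
Proof.
  unfold Omega. generalize n at 1 as f. intros f. revert n t.
  induction f as [|f IH]; intros n t; [easy|].
  destruct n as [|[|n]]; [easy| |].
  - simpl. now intros [<-|[]].
  - rewrite trees_fuel_rec. intros H.
    apply in_flat_map in H as [k [Hk H]]. apply in_flat_map in H as [l [Hl H]].
    apply in_map_iff in H as [r [<- Hr]].
    apply IH in Hl, Hr. apply in_seq in Hk. simpl. lia.
Qed.

Definition ind_prune (s t : tree) : R :=
  match prune t with None => 0 | Some u => ind_tree s u end.

Lemma ind_leaf_prune t : ind_tree Leaf t = match prune t with None => 1 | Some _ => 0 end.
Proof.
  unfold ind_tree. destruct (tree_eq_dec t Leaf) as [->|Hn]; [easy|].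
  destruct (prune t) eqn:E; [easy|]. now apply prune_none in E.
Qed.

(** Three cases at the root: both subtrees survive pruning, or exactly one of them is a leaf and the
    other is pruned to [s]. Two leaves would give [Leaf], which the second hypothesis excludes. The
    last two cases produce the term $2z$ of [geom2_div]. *)
Lemma tsum_ind_prune_eq s h1 h2 :
  (forall a b, ind_tree s (Node a b) = h1 a * h2 b) ->
  ind_tree s Leaf = 0 ->
  tsum (ind_prune s) =
    fadd (conv (tsum (fun t => match prune t with None => 0 | Some u => h1 u end))
               (tsum (fun t => match prune t with None => 0 | Some u => h2 u end)))
         (fadd (conv Z1 (tsum (ind_prune s))) (conv Z1 (tsum (ind_prune s)))).
Proof.
  intros Hs HL.
  set (p1 := fun t => match prune t with None => 0 | Some u => h1 u end).
  set (p2 := fun t => match prune t with None => 0 | Some u => h2 u end).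
  set (F1 := fun t => match t with Leaf => 0 | Node l r => p1 l * p2 r end).
  set (F2 := fun t => match t with Leaf => 0 | Node l r => ind_prune s l * ind_tree Leaf r end).
  set (F3 := fun t => match t with Leaf => 0 | Node l r => ind_tree Leaf l * ind_prune s r end).
  rewrite (tsum_ext (ind_prune s) (fun t => F1 t + (F2 t + F3 t))) at 1.
  2:{ intros [|l r]; [unfold ind_prune; simpl; ring|].
      unfold F1, F2, F3, p1, p2. rewrite !ind_leaf_prune. unfold ind_prune. simpl.
      destruct (prune l), (prune r); try ring; rewrite ?Hs, ?HL; ring. }
  rewrite tsum_plus, tsum_plus.
  rewrite (tsum_split F1 p1 p2) by easy.
  rewrite (tsum_split F2 (ind_prune s) (ind_tree Leaf)) by easy.
  rewrite (tsum_split F3 (ind_tree Leaf) (ind_prune s)) by easy.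
  rewrite tsum_ind_leaf. simpl. ring.
Qed.

Lemma tsum_ind_prune_node a b :
  tsum (ind_prune (Node a b)) =
    conv geom2 (conv (tsum (ind_prune a)) (tsum (ind_prune b))).
Proof.
  apply geom2_div. apply (tsum_ind_prune_eq _ (ind_tree a) (ind_tree b)).
  - apply ind_tree_node.
  - unfold ind_tree. now destruct (tree_eq_dec _ _).
Qed.

Lemma tsum_ind_prune_leaf : tsum (ind_prune Leaf) = conv geom2 (conv Z1 Z1).
Proof.
  apply geom2_div.
  set (F1 := fun t => match t with Leaf => 0 | Node l r => ind_tree Leaf l * ind_tree Leaf r end).
  set (F2 := fun t => match t with Leaf => 0 | Node l r => ind_prune Leaf l * ind_tree Leaf r end).
  set (F3 := fun t => match t with Leaf => 0 | Node l r => ind_tree Leaf l * ind_prune Leaf r end).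
  rewrite (tsum_ext (ind_prune Leaf) (fun t => F1 t + (F2 t + F3 t))) at 1.
  2:{ intros [|l r]; [unfold ind_prune; simpl; ring|].
      unfold F1, F2, F3. rewrite !(ind_leaf_prune l), !(ind_leaf_prune r).
      unfold ind_prune. simpl.
      destruct (prune l), (prune r); unfold ind_tree;
        repeat destruct (tree_eq_dec _ _); try ring; congruence. }
  rewrite tsum_plus, tsum_plus.
  rewrite (tsum_split F1 (ind_tree Leaf) (ind_tree Leaf)) by easy.
  rewrite (tsum_split F2 (ind_prune Leaf) (ind_tree Leaf)) by easy.
  rewrite (tsum_split F3 (ind_tree Leaf) (ind_prune Leaf)) by easy.
  rewrite tsum_ind_leaf. simpl. ring.
Qed.

(* [z^(2m) / (1 - 2z)^(2m-1)] with [m = k + 1]: each of the [2m - 1] edges of the pruned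
   tree carries a sequence of left or right leaves. *)
Fixpoint pser (k : nat) : fps :=
  match k with
  | O => conv geom2 (conv Z1 Z1)
  | S k' => conv (conv (conv Z1 Z1) (conv geom2 geom2)) (pser k')
  end.

(** Joining pruned trees with $m_1$ and $m_2$ leaves under a new root adds one sequence of leaves:
    $(2m_1-1)+(2m_2-1)+1 = 2(m_1+m_2)-1$. *)
Lemma pser_add j k : conv geom2 (conv (pser j) (pser k)) = pser (S (j + k)).
Proof.
  induction j as [|j IH]; [simpl; ring|].
  cbn [pser Nat.add] in *. rewrite <- IH. ring.
Qed.

(** The shape of [s] enters only through its number of leaves, which is why the pruned tree is
    uniform given its size. *)
Lemma tsum_ind_prune s : tsum (ind_prune s) = pser (leaves s - 1).
Proof.
  induction s as [|a IHa b IHb]; [apply tsum_ind_prune_leaf|].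
  rewrite tsum_ind_prune_node, IHa, IHb, pser_add. f_equal.
  pose proof (leaves_pos a). pose proof (leaves_pos b). simpl. lia.
Qed.

(** * Counting trees by the size of the pruned tree *)

Definition nprune (n m : nat) : R := match m with O => 0 | S k => pser k n end.

Lemma sum_prune n (g : tree -> R) :
  lsum (fun t => match prune t with None => 0 | Some s => g s end) (Omega n) =
  psum (fun m => nprune n m * lsum g (Omega m)) (S n).
Proof.
  rewrite (lsum_ext_in _ (fun t =>
    psum (fun m => lsum (fun s => ind_prune s t * g s) (Omega m)) (S n))).
  - unfold psum. rewrite lsum_swap. apply lsum_ext_in; intros m _.
    rewrite lsum_swap, <- lsum_scal. apply lsum_ext_in; intros s Hs.
    rewrite (lsum_ext_in _ (fun t => g s * ind_prune s t)) by (intros; ring).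
    rewrite lsum_scal. fold (tsum (ind_prune s) n). rewrite tsum_ind_prune.
    apply Omega_leaves in Hs. pose proof (leaves_pos s). subst m.
    destruct (leaves s) as [|k]; [lia|]. simpl. rewrite Nat.sub_0_r. ring.
  - intros t Ht. apply Omega_leaves in Ht. unfold ind_prune.
    destruct (prune t) as [s|] eqn:E.
    + apply prune_leaves in E. rewrite (sum_ind_tree n s g) by lia. easy.
    + unfold psum. rewrite (lsum_ext_in _ (fun _ => 0)), lsum_const; [ring|].
      intros m _. rewrite (lsum_ext_in _ (fun _ => 0)), lsum_const; [ring|].
      intros; ring.
Qed.

Lemma pser_nonneg k n : 0 <= pser k n.
Proof.
  assert (HZ : forall i, 0 <= Z1 i) by (intros [|[|i]]; simpl; lra).
  assert (HG : forall i, 0 <= geom2 i) by (intros i; apply pow_le; lra).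
  revert n; induction k as [|k IH]; intros n; simpl; repeat (apply conv_nonneg; intros); auto.
Qed.

Lemma fpow_Z1_low j f n : (n < j)%nat -> conv (fpow Z1 j) f n = 0.
Proof.
  revert n; induction j as [|j IH]; intros n Hn; [lia|].
  cbn [fpow]. replace (conv (conv Z1 (fpow Z1 j)) f) with (conv Z1 (conv (fpow Z1 j) f)) by ring.
  destruct n as [|n]; [apply conv_Z1_0|]. rewrite conv_Z1_S. apply IH. lia.
Qed.

Lemma pser_low k n : (n < 2 * S k)%nat -> pser k n = 0.
Proof.
  assert (H : exists h, pser k = conv (fpow Z1 (2 * S k)) h).
  { induction k as [|k [h IH]].
    - exists geom2. simpl. ring.
    - exists (conv (conv geom2 geom2) h). cbn [pser]. rewrite IH.
      replace (2 * S (S k))%nat with (S (S (2 * S k))) by lia. cbn [fpow]. ring. }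
  destruct H as [h ->]. apply fpow_Z1_low.
Qed.

(** The logarithmic derivative of $z^{2m}(1-2z)^{-(2m-1)}$ with $m = k+1$ is $2m +
    (2m-1)\,2z/(1-2z)$. *)
Lemma theta_pser k :
  theta (pser k) =
  fadd (conv (cst (2 * INR k + 2)) (pser k))
       (conv (cst (4 * INR k + 2)) (conv Z1 (conv geom2 (pser k)))).
Proof.
  assert (E2 : cst 2 = fadd (cst 1) (cst 1)) by (rewrite <- cst_add; f_equal; ring).
  induction k as [|k IH].
  - simpl INR. replace (2 * 0 + 2) with 2 by ring. replace (4 * 0 + 2) with 2 by ring.
    cbn [pser]. rewrite !theta_conv, theta_Z1, theta_geom2, E2. ring.
  - rewrite S_INR. cbn [pser]. rewrite !theta_conv, theta_Z1, theta_geom2, IH.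
    replace (2 * (INR k + 1) + 2) with ((2 * INR k + 2) + 2) by ring.
    replace (4 * (INR k + 1) + 2) with ((4 * INR k + 2) + (2 + 2)) by ring.
    rewrite (cst_add (2 * INR k + 2) 2), (cst_add (4 * INR k + 2)), (cst_add 2 2), E2.
    ring.
Qed.

(** The same computation for $z^{2k+3}(1-2z)^{-(2k+2)}$; multiplying by $z/(1-2z)$ a second time
    reaches [pser (S k)]. *)
Lemma theta_pser_shift k :
  theta (conv Z1 (conv geom2 (pser k))) =
  fadd (conv (cst (2 * INR k + 3)) (conv Z1 (conv geom2 (pser k))))
       (conv (cst (4 * INR k + 4)) (pser (S k))).
Proof.
  cbn [pser]. rewrite !theta_conv, theta_Z1, theta_geom2, theta_pser.
  replace (2 * INR k + 3) with ((2 * INR k + 2) + 1) by ring.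
  replace (4 * INR k + 4) with ((4 * INR k + 2) + (1 + 1)) by ring.
  rewrite (cst_add (2 * INR k + 2) 1), (cst_add (4 * INR k + 2)), (cst_add 1 1).
  ring.
Qed.

(** The two differential equations give $(n-2m)p = (4k+2)y$ and $(n-2m-1)y = (4k+4)q$, with $m =
    k+1$ and $y$ the coefficient of the intermediate series. Eliminating $y$ leaves the
    recurrence. *)
Lemma pser_rec k n :
  (INR n - 2 * INR (S k)) * (INR n - 2 * INR (S k) - 1) * pser k n =
  8 * INR (S k) * (2 * INR (S k) - 1) * pser (S k) n.
Proof.
  pose proof (f_equal (fun f => f n) (theta_pser k)) as H1.
  pose proof (f_equal (fun f => f n) (theta_pser_shift k)) as H2.
  cbv beta in H1, H2. unfold fadd in H1, H2. rewrite !conv_cst in H1, H2.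
  unfold theta in H1, H2. rewrite S_INR.
  set (y := conv Z1 (conv geom2 (pser k)) n) in *.
  set (p := pser k n) in *. set (q := pser (S k) n) in *.
  replace ((INR n - 2 * (INR k + 1)) * (INR n - 2 * (INR k + 1) - 1) * p)
    with ((INR n - 2 * (INR k + 1) - 1) * (INR n * p - (2 * INR k + 2) * p)) by ring.
  rewrite H1.
  replace ((INR n - 2 * (INR k + 1) - 1) *
    ((2 * INR k + 2) * p + (4 * INR k + 2) * y - (2 * INR k + 2) * p))
    with ((4 * INR k + 2) * (INR n * y - (2 * INR k + 3) * y)) by ring.
  rewrite H2. ring.
Qed.

(* The probability that a uniform tree with [n] leaves is pruned to a tree with [m] leaves,
   that is, has [m] branches of order 2. *)
Definition prune_law (n m : nat) : R := nprune n m * catalan m / catalan n.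

Lemma prune_law_0 n : prune_law n 0 = 0.
Proof. unfold prune_law, nprune, Rdiv. ring. Qed.

Lemma prune_law_nonneg n m : (1 <= n)%nat -> 0 <= prune_law n m.
Proof.
  intros Hn. destruct m as [|k]; [rewrite prune_law_0; lra|].
  unfold prune_law. apply Rdiv_le_0_compat; [|now apply catalan_pos].
  apply Rmult_le_pos; [apply pser_nonneg|].
  apply Rlt_le, catalan_pos. lia.
Qed.

Lemma prune_law_low n m : (n < 2 * m)%nat -> prune_law n m = 0.
Proof.
  intros H. destruct m as [|k]; [lia|]. unfold prune_law, nprune.
  rewrite pser_low by lia. unfold Rdiv. ring.
Qed.

(** The factor $2m-1$ of [pser_rec] is absorbed by the Catalan recurrence, which trades it for
    $m+1$. *)
Lemma prune_law_rec n m :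
  4 * INR m * (INR m + 1) * prune_law n (S m) = (INR n - 2 * INR m) * (INR n - 2 * INR m - 1) * prune_law n m.
Proof.
  destruct m as [|k]; [rewrite prune_law_0; simpl; ring|].
  unfold prune_law, nprune, Rdiv.
  pose proof (pser_rec k n) as H1. pose proof (catalan_rec (S k) ltac:(lia)) as H2.
  rewrite (S_INR (S k)) in H2.
  replace (4 * INR (S k) * (INR (S k) + 1) * (pser (S k) n * catalan (S (S k)) * / catalan n))
    with (4 * INR (S k) * pser (S k) n * ((INR (S k) + 1) * catalan (S (S k))) * / catalan n) by ring.
  rewrite H2.
  replace ((INR n - 2 * INR (S k)) * (INR n - 2 * INR (S k) - 1) * (pser k n * catalan (S k) * / catalan n))
    with ((INR n - 2 * INR (S k)) * (INR n - 2 * INR (S k) - 1) * pser k n * (catalan (S k) * / catalan n)) by ring.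
  rewrite H1. ring.
Qed.

(** * Probabilities conditioned on the pruned tree *)

Definition b2r (b : bool) : R := if b then 1 else 0.

Lemma Pn_lsum n A : Pn n A = lsum (fun t => b2r (A t)) (Omega n) / catalan n.
Proof. unfold Pn, b2r. now rewrite lsum_filter, catalan_length. Qed.

Lemma Pn_prune n A (B : tree -> bool) : (2 <= n)%nat ->
  (forall t s, leaves t = n -> prune t = Some s -> A t = B s) ->
  Pn n A = psum (fun m => prune_law n m * Pn m B) (S n).
Proof.
  intros Hn HAB. rewrite Pn_lsum.
  rewrite (lsum_ext_in _ (fun t => match prune t with None => 0 | Some s => b2r (B s) end)).
  - rewrite (sum_prune n (fun s => b2r (B s))). unfold psum.
    unfold Rdiv. rewrite Rmult_comm, <- lsum_scal. apply lsum_ext_in; intros m _.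
    (* [Pn 0] is a quotient by zero, so size 0 is treated apart: its weight [prune_law n 0]
       vanishes. *)
    rewrite Pn_lsum. destruct m as [|m].
    + rewrite prune_law_0. unfold nprune. ring.
    + unfold prune_law. pose proof (catalan_pos n ltac:(lia)). pose proof (catalan_pos (S m) ltac:(lia)).
      field. lra.
  - intros t Ht. apply Omega_leaves in Ht.
    destruct (prune t) as [s|] eqn:E.
    + now rewrite (HAB t s).
    + apply prune_none in E. subst t. simpl in Ht. lia.
Qed.

Lemma Pn_true n : (1 <= n)%nat -> Pn n (fun _ => true) = 1.
Proof.
  intros Hn. rewrite Pn_lsum. unfold b2r. fold (tsum (fun _ => 1) n). fold catalan.
  pose proof (catalan_pos n Hn). field. lra.
Qed.

Lemma prune_law_total n : (2 <= n)%nat -> psum (prune_law n) (S n) = 1.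
Proof.
  intros Hn. rewrite <- (Pn_true n) by lia.
  rewrite (Pn_prune n (fun _ => true) (fun _ => true)) by easy.
  apply lsum_ext_in; intros m _. destruct m as [|m]; [rewrite prune_law_0; ring|].
  rewrite Pn_true by lia. ring.
Qed.

Lemma Pn_monotone n A B : (forall t, leaves t = n -> A t = true -> B t = true) -> Pn n A <= Pn n B.
Proof.
  intros H. destruct n as [|n].
  - unfold Pn. simpl. lra.
  - rewrite !Pn_lsum. apply Rmult_le_compat_r.
    + apply Rlt_le, Rinv_0_lt_compat, catalan_pos. lia.
    + apply lsum_le_in; intros t Ht. apply Omega_leaves in Ht. specialize (H t Ht).
      unfold b2r. destruct (A t), (B t); try lra; now discriminate H.
Qed.

Lemma Pn_bounds n A : 0 <= Pn n A <= 1.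
Proof.
  destruct n as [|n].
  - unfold Pn. simpl. unfold Rdiv. rewrite Rmult_0_l. lra.
  - split.
    + unfold Pn. apply Rdiv_le_0_compat; [apply pos_INR|].
      rewrite <- catalan_length. apply catalan_pos. lia.
    + rewrite <- (Pn_true (S n)) by lia. now apply Pn_monotone.
Qed.

(** * Horton-Strahler branches and pruning *)

Lemma hs_order_pos t : (1 <= hs_order t)%nat.
Proof.
  induction t as [|l IHl r IHr]; simpl; [lia|].
  destruct (Nat.eqb _ _); lia.
Qed.

(** A subtree that survives pruning has order at least 2, so a leaf as its sibling does not change
    the order: a contracted vertex has the order of its surviving child. *)
Lemma hs_order_prune t s : prune t = Some s -> hs_order t = S (hs_order s).
Proof.
  revert s; induction t as [|l IHl r IHr]; simpl; [easy|]. intros s.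
  destruct (prune l) as [a|] eqn:El, (prune r) as [b|] eqn:Er; intros E; injection E as <-.
  - rewrite (IHl a), (IHr b) by easy. simpl.
    destruct (Nat.eqb _ _); lia.
  - apply prune_none in Er as ->. rewrite (IHl a) by easy. simpl.
    pose proof (hs_order_pos a). destruct (Nat.eqb_spec (hs_order a) 0); lia.
  - apply prune_none in El as ->. rewrite (IHr b) by easy. simpl.
    pose proof (hs_order_pos b). destruct (hs_order b); lia.
  - apply prune_none in El as ->. apply prune_none in Er as ->. easy.
Qed.

Definition top_here (k : nat) (po : option nat) (o : nat) : nat :=
  if Nat.eqb o k then
    match po with None => 1 | Some p => if Nat.eqb p k then 0 else 1 end
  else 0.

Lemma branch_tops_node k po l r :
  branch_tops k po (Node l r) =
  (top_here k po (hs_order (Node l r)) + branch_tops k (Some (hs_order (Node l r))) l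
   + branch_tops k (Some (hs_order (Node l r))) r)%nat.
Proof. easy. Qed.

Lemma branch_tops_leaf k po : branch_tops k po Leaf = top_here k po 1.
Proof. easy. Qed.

(** Accounts for contraction: below a vertex of its own order, a root is not a top, and the vertex
    above carries the count [top_here] in its place. *)
Lemma branch_tops_parent k po t :
  branch_tops k po t = (top_here k po (hs_order t) + branch_tops k (Some (hs_order t)) t)%nat.
Proof.
  destruct t as [|l r]; rewrite ?branch_tops_leaf, ?branch_tops_node; unfold top_here;
    cbn [hs_order]; destruct (Nat.eqb _ k); lia.
Qed.

Lemma branch_tops_prune k t s po : (1 <= k)%nat -> prune t = Some s ->
  branch_tops (S k) (option_map S po) t = branch_tops k po s.
Proof.
  intros Hk. revert s po.
  assert (Ht : forall po o, top_here (S k) (option_map S po) (S o) = top_here k po o).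
  { intros [p|] o; easy. }
  assert (Hl : forall po, branch_tops (S k) po Leaf = 0%nat).
  { intros po. rewrite branch_tops_leaf. unfold top_here.
    destruct k as [|k]; [lia|]. easy. }
  induction t as [|l IHl r IHr]; [easy|]. intros s po Hp.
  rewrite branch_tops_node, (hs_order_prune _ _ Hp), Ht.
  change (Some (S (hs_order s))) with (option_map S (Some (hs_order s))).
  simpl in Hp.
  destruct (prune l) as [a|] eqn:El, (prune r) as [b|] eqn:Er; injection Hp as <-.
  - rewrite (IHl a), (IHr b) by easy. now rewrite branch_tops_node.
  - apply prune_none in Er as ->. rewrite Hl, (IHl a) by easy.
    rewrite (branch_tops_parent k po). lia.
  - apply prune_none in El as ->. rewrite Hl, (IHr b) by easy.
    rewrite (branch_tops_parent k po). lia.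
  - apply prune_none in El as ->. apply prune_none in Er as ->.
    rewrite !Hl, branch_tops_leaf. simpl hs_order. lia.
Qed.

Lemma S_branches_prune k t s : (1 <= k)%nat -> prune t = Some s ->
  S_branches (S k) t = S_branches k s.
Proof. intros Hk Hp. exact (branch_tops_prune k t s None Hk Hp). Qed.

(** Every internal node has order at least 2, so each leaf is a branch by itself. The hypothesis on
    [po] in the induction records this for the parent. *)
Lemma S_branches_1 t : S_branches 1 t = leaves t.
Proof.
  unfold S_branches.
  assert (H : forall po, po <> Some 1%nat -> branch_tops 1 po t = leaves t); [|now apply H].
  induction t as [|l IHl r IHr]; intros po Hpo.
  - rewrite branch_tops_leaf. destruct po as [[|[|p]]|]; easy.
  - rewrite branch_tops_node.
    assert (Ho : (2 <= hs_order (Node l r))%nat).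
    { cbn [hs_order]. pose proof (hs_order_pos l). pose proof (hs_order_pos r).
      destruct (Nat.eqb_spec (hs_order l) (hs_order r)); lia. }
    revert Ho. generalize (hs_order (Node l r)) as o. intros o Ho.
    rewrite IHl, IHr by (intros E; injection E; lia).
    unfold top_here. destruct (Nat.eqb_spec o 1); [lia|easy].
Qed.

Lemma bif_ratio_prune r t s : (1 <= r)%nat -> prune t = Some s ->
  bif_ratio (S r) t = bif_ratio r s.
Proof.
  intros Hr Hp. unfold bif_ratio.
  now rewrite (S_branches_prune (S r) t s), (S_branches_prune r t s) by (lia || easy).
Qed.

Lemma bif_ratio_1 t s : prune t = Some s -> bif_ratio 1 t = INR (leaves s) / INR (leaves t).
Proof.
  intros Hp. unfold bif_ratio.
  rewrite (S_branches_prune 1 t s) by easy. rewrite !S_branches_1.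
  pose proof (leaves_pos t). destruct (leaves t); [lia|easy].
Qed.

Lemma le_event_true r n x t : le_event r n x t = true <-> stat r n t <= x.
Proof. unfold le_event. now destruct (Rle_dec _ _). Qed.

Lemma bool_eq_iff (a b : bool) : (a = true <-> b = true) -> a = b.
Proof. destruct a, b; intuition congruence. Qed.

Lemma Pn_le_event_1 n y : (2 <= n)%nat ->
  Pn n (le_event 1 n y) =
  psum (fun m => prune_law n m *
    b2r (if Rle_dec (sqrt (INR n) * (INR m / INR n - 1 / 4)) y then true else false)) (S n).
Proof.
  intros Hn.
  rewrite (Pn_prune n _ (fun s =>
    if Rle_dec (sqrt (INR n) * (INR (leaves s) / INR n - 1 / 4)) y then true else false)).
  - apply lsum_ext_in; intros m _. destruct m as [|m]; [rewrite prune_law_0; ring|].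
    f_equal. rewrite Pn_lsum.
    set (c := b2r _).
    rewrite (lsum_ext_in _ (fun _ => c)).
    + rewrite lsum_const, <- catalan_length. pose proof (catalan_pos (S m) ltac:(lia)). field. lra.
    + intros t Ht. apply Omega_leaves in Ht. unfold c. now rewrite Ht.
  - easy.
  - intros t s Ht Hp. unfold le_event, stat. rewrite (bif_ratio_1 t s Hp), Ht. easy.
Qed.

Lemma Pn_le_event_S r n x : (1 <= r)%nat -> (2 <= n)%nat ->
  Pn n (le_event (S r) n x) =
  psum (fun m => prune_law n m * Pn m (le_event r m (x * sqrt (INR m / INR n)))) (S n).
Proof.
  intros Hr Hn.
  rewrite (Pn_prune n _ (fun s => le_event r (leaves s) (x * sqrt (INR (leaves s) / INR n)) s)).
  - apply lsum_ext_in; intros m _. f_equal. rewrite !Pn_lsum. f_equal.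
    apply lsum_ext_in; intros t Ht. apply Omega_leaves in Ht. now rewrite Ht.
  - easy.
  - intros t s Ht Hp. apply bool_eq_iff. rewrite !le_event_true.
    unfold stat. rewrite (bif_ratio_prune r t s Hr Hp).
    assert (Hm : 0 < INR (leaves s)) by (apply lt_0_INR; pose proof (leaves_pos s); lia).
    assert (Hn' : 0 < INR n) by (apply lt_0_INR; lia).
    rewrite sqrt_div by lra.
    apply sqrt_lt_R0 in Hm, Hn'.
    set (a := sqrt (INR (leaves s))) in *. set (b := sqrt (INR n)) in *.
    set (v := bif_ratio r s - 1 / 4).
    (* Both events say that the centred ratio is at most $x/\sqrt n$. *)
    replace (x * (a / b)) with (x / b * a) by (field; lra).
    replace (b * v) with (v * b) by ring. replace (a * v) with (v * a) by ring.
    split; intros H.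
    + apply Rmult_le_compat_r; [lra|]. now apply Rle_div_r.
    + apply Rmult_le_reg_r in H; [|lra]. now apply Rle_div_r in H.
Qed.

(** * The Gaussian integral *)

Definition gauss (x : R) : R := exp (- x ^ 2).
Definition gint (x : R) : R := RInt gauss 0 x.

Lemma continuous_gauss (x : R) : continuous gauss x.
Proof.
  apply (ex_derive_continuous gauss). unfold gauss. auto_derive. easy.
Qed.

Lemma ex_RInt_gauss a b : ex_RInt gauss a b.
Proof. apply (ex_RInt_continuous gauss). intros; apply continuous_gauss. Qed.

Lemma is_derive_gint (x : R) : is_derive gint x (gauss x).
Proof.
  apply (is_derive_RInt gauss gint 0 x); [|apply continuous_gauss].
  apply filter_forall. intros b. apply (RInt_correct gauss), ex_RInt_gauss.
Qed.

(* The companion of [gint ^ 2]: the sum of the two is constant in [x]. *)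
Definition gker (x t : R) : R := exp (- (x ^ 2 * (1 + t ^ 2))) / (1 + t ^ 2).
Definition gcomp (x : R) : R := RInt (fun t => gker x t) 0 1.

Lemma one_plus_sq_pos t : 0 < 1 + t ^ 2.
Proof. nra. Qed.

Lemma is_derive_gker (x t : R) :
  is_derive (fun u => gker u t) x (- (2 * x) * exp (- (x ^ 2 * (1 + t ^ 2)))).
Proof.
  pose proof (one_plus_sq_pos t). unfold gker. auto_derive; [easy|]. simpl. field. lra.
Qed.

Lemma ex_RInt_gker x a b : ex_RInt (fun t => gker x t) a b.
Proof.
  apply (ex_RInt_continuous (fun t => gker x t)). intros t _.
  apply (ex_derive_continuous (fun t => gker x t)). unfold gker.
  pose proof (one_plus_sq_pos t). auto_derive. lra.
Qed.

(** Differentiating under the integral cancels the denominator $1+t^2$; the factor $e^{-x^2}$ comes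
    out, and the substitution $u = xt$ turns the rest into [gint]. *)
Lemma is_derive_gcomp (x : R) : is_derive gcomp x (- (2 * gauss x * gint x)).
Proof.
  assert (E : RInt (fun t => Derive (fun u => gker u t) x) 0 1 = - (2 * gauss x * gint x)).
  { apply is_RInt_unique.
    apply (is_RInt_ext (fun t => scal (- (2 * gauss x)) (scal x (gauss (x * t + 0))))).
    - intros t _. rewrite (is_derive_unique (fun u : R => gker u t) x _ (is_derive_gker x t)).
      unfold gauss, scal; simpl; unfold mult; simpl.
      replace (- (x * (x * 1) * (1 + t * (t * 1))))
        with (- (x * (x * 1)) + - ((x * t + 0) * ((x * t + 0) * 1))) by ring.
      rewrite exp_plus. ring.
    - replace (- (2 * gauss x * gint x)) with (scal (- (2 * gauss x)) (gint x))
        by (unfold scal; simpl; unfold mult; simpl; ring).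
      apply (@is_RInt_scal R_NormedModule), (is_RInt_comp_lin gauss).
      replace (x * 0 + 0) with 0 by ring. replace (x * 1 + 0) with x by ring.
      apply (RInt_correct gauss), ex_RInt_gauss. }
  rewrite <- E. apply (is_derive_RInt_param gker).
  - apply filter_forall. intros y t _. eexists. apply is_derive_gker.
  - intros t _.
    apply continuity_2d_pt_ext with (fun u v => - (2 * u) * exp (- (u ^ 2 * (1 + v ^ 2)))).
    { intros u v. symmetry. apply is_derive_unique, is_derive_gker. }
    assert (Hu : continuity_2d_pt (fun u v => u) x t) by apply continuity_2d_pt_id1.
    assert (Hv : continuity_2d_pt (fun u v => v) x t) by apply continuity_2d_pt_id2.
    apply continuity_2d_pt_mult.
    + apply continuity_2d_pt_opp, continuity_2d_pt_mult; [apply continuity_2d_pt_const|easy].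
    + apply (continuity_1d_2d_pt_comp exp).
      * apply derivable_continuous_pt, derivable_pt_exp.
      * apply continuity_2d_pt_opp, continuity_2d_pt_mult.
        -- apply continuity_2d_pt_ext with (fun u v => u * u); [intros; ring|].
           now apply continuity_2d_pt_mult.
        -- apply continuity_2d_pt_plus; [apply continuity_2d_pt_const|].
           apply continuity_2d_pt_ext with (fun u v => v * v); [intros; ring|].
           now apply continuity_2d_pt_mult.
  - apply filter_forall. intros y. apply ex_RInt_gker.
Qed.

Lemma gint_0 : gint 0 = 0.
Proof. apply (RInt_point 0 gauss). Qed.

Lemma gcomp_0 : gcomp 0 = PI / 4.
Proof.
  unfold gcomp. rewrite <- atan_1.
  replace (atan 1) with (minus (atan 1) (atan 0))
    by (rewrite atan_0; unfold minus, plus, opp; simpl; ring).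
  apply is_RInt_unique. apply (is_RInt_ext (fun t => / (1 + t ^ 2))).
  { intros t _. unfold gker. pose proof (one_plus_sq_pos t).
    change (/ (1 + t ^ 2) = exp (- (0 ^ 2 * (1 + t ^ 2))) / (1 + t ^ 2)).
    replace (- (0 ^ 2 * (1 + t ^ 2))) with 0 by ring. rewrite exp_0. field. simpl in *; lra. }
  apply (is_RInt_derive atan).
  - intros t _. rewrite <- Rsqr_pow2. apply is_derive_atan.
  - intros t _. apply (ex_derive_continuous (fun t => / (1 + t ^ 2))).
    pose proof (one_plus_sq_pos t). auto_derive. lra.
Qed.

(** The two derivatives cancel and the value at 0 is $\arctan 1$. Since [gcomp] decays at infinity,
    this yields the Gaussian integral. *)
Lemma gint_gcomp x : gint x ^ 2 + gcomp x = PI / 4.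
Proof.
  replace (PI / 4) with (gint 0 ^ 2 + gcomp 0) by (rewrite gint_0, gcomp_0; ring).
  set (h := fun x => gint x ^ 2 + gcomp x).
  assert (Hd : forall c, is_derive h c 0).
  { intros c. replace 0 with (2 * gint c ^ 1 * gauss c + - (2 * gauss c * gint c)) by ring.
    apply (is_derive_plus (fun x => gint x ^ 2) gcomp); [|apply is_derive_gcomp].
    apply is_derive_ext with (fun x => gint x * gint x); [intros; simpl; ring|].
    replace (2 * gint c ^ 1 * gauss c) with (gauss c * gint c + gint c * gauss c) by ring.
    apply (is_derive_mult gint gint); try apply is_derive_gint.
    intros; apply Rmult_comm. }
  destruct (MVT_gen h 0 x (fun _ => 0)) as [c [_ Hc]].
  - intros; apply Hd.
  - intros y _. apply continuity_pt_filterlim, (ex_derive_continuous h). exists 0; apply Hd.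
  - change (h x = h 0). lra.
Qed.

Lemma gint_odd x : gint (- x) = - gint x.
Proof.
  apply is_RInt_unique. apply (is_RInt_ext (fun t => opp (opp (gauss (- t))))).
  - intros t _. rewrite opp_opp. unfold gauss. f_equal. ring.
  - apply (@is_RInt_opp R_NormedModule (fun t => opp (gauss (- t)))), (@is_RInt_comp_opp R_NormedModule gauss).
    rewrite Ropp_0, Ropp_involutive. apply (RInt_correct gauss), ex_RInt_gauss.
Qed.

Lemma gint_nonneg x : 0 <= x -> 0 <= gint x.
Proof.
  intros Hx. apply RInt_ge_0; [easy|apply ex_RInt_gauss|].
  intros; apply Rlt_le, exp_pos.
Qed.

Lemma gcomp_bounds x : 0 < x -> 0 <= gcomp x <= / x ^ 2.
Proof.
  intros Hx. split.
  - apply RInt_ge_0; [lra|apply ex_RInt_gker|]. intros t _. unfold gker.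
    apply Rdiv_le_0_compat; [apply Rlt_le, exp_pos|apply one_plus_sq_pos].
  - replace (/ x ^ 2) with (RInt (fun _ => / x ^ 2) 0 1).
    2:{ rewrite RInt_const. unfold scal; simpl; unfold mult; simpl. field. lra. }
    apply RInt_le; [lra|apply ex_RInt_gker|apply ex_RInt_const|].
    intros t _. unfold gker. pose proof (one_plus_sq_pos t). rewrite exp_Ropp.
    assert (0 < x ^ 2) by (apply pow_lt; lra).
    assert (1 + x ^ 2 * (1 + t ^ 2) <= exp (x ^ 2 * (1 + t ^ 2))) by apply exp_ineq1_le.
    assert (x ^ 2 <= exp (x ^ 2 * (1 + t ^ 2))) by nra.
    unfold Rdiv. rewrite <- Rinv_mult. apply Rinv_le_contravar; [easy|]. nra.
Qed.

Lemma gint_tail x : 0 < x -> sqrt PI / 2 - 1 / x <= gint x <= sqrt PI / 2.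
Proof.
  intros Hx. pose proof (gint_gcomp x). pose proof (gcomp_bounds x Hx).
  pose proof (gint_nonneg x ltac:(lra)). pose proof PI_RGT_0.
  pose proof (sqrt_lt_R0 PI ltac:(easy)).
  pose proof (sqrt_sqrt PI ltac:(lra)).
  assert (Hi : 0 < / x) by now apply Rinv_0_lt_compat.
  replace (/ x ^ 2) with (/ x * / x) in H0 by (field; lra).
  unfold Rdiv at 2. rewrite Rmult_1_l.
  set (s := sqrt PI) in *. set (g := gint x) in *. set (i := / x) in *.
  split.
  - destruct (Rle_lt_dec (s / 2 - i) 0); [lra|].
    apply Rnot_lt_le; intros Hlt. nra.
  - apply Rnot_lt_le; intros Hlt. nra.
Qed.

(** * The standard normal distribution function *)

(** Expressed by a proper integral, which gives derivative, symmetry and tails directly;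
    [normal_cdf_Phi] identifies it with the improper integral. *)
Definition Phi (x : R) : R := 1 / 2 + gint (x / sqrt 2) / sqrt PI.

Lemma sqrtPI_pos : 0 < sqrt PI.
Proof. apply sqrt_lt_R0, PI_RGT_0. Qed.

Lemma sqrt2_pos : 0 < sqrt 2.
Proof. apply sqrt_lt_R0; lra. Qed.

Lemma is_derive_Phi (x : R) : is_derive Phi x (exp (- x ^ 2 / 2) / sqrt (2 * PI)).
Proof.
  pose proof sqrtPI_pos. pose proof sqrt2_pos. pose proof PI_RGT_0.
  rewrite sqrt_mult by lra. unfold Phi.
  replace (exp (- x ^ 2 / 2) / (sqrt 2 * sqrt PI))
    with (0 + / sqrt PI * (/ sqrt 2 * gauss (x / sqrt 2))).
  - apply (is_derive_plus (fun _ => 1 / 2) (fun x => gint (x / sqrt 2) / sqrt PI)).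
    + apply (is_derive_const (1 / 2) x).
    + apply is_derive_ext with (fun x => / sqrt PI * gint (x / sqrt 2)).
      { intros t. unfold Rdiv. apply Rmult_comm. }
      apply (is_derive_scal (fun x => gint (x / sqrt 2))).
      apply (is_derive_comp gint (fun x => x / sqrt 2)); [apply is_derive_gint|].
      auto_derive; [easy|]. field. lra.
  - unfold gauss. replace (- (x / sqrt 2) ^ 2) with (- x ^ 2 / 2).
    + field. lra.
    + replace ((x / sqrt 2) ^ 2) with (x ^ 2 / (sqrt 2 * sqrt 2)) by (field; lra).
      rewrite sqrt_sqrt by lra. field.
Qed.

Lemma continuous_Phi (x : R) : continuous Phi x.
Proof. apply (ex_derive_continuous Phi). eexists; apply is_derive_Phi. Qed.

Lemma Phi_low x : 0 < x -> 0 <= Phi (- x) <= 1 / x.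
Proof.
  intros Hx. pose proof sqrtPI_pos. pose proof sqrt2_pos. unfold Phi.
  replace (- x / sqrt 2) with (- (x / sqrt 2)) by (field; lra).
  rewrite gint_odd.
  assert (Hp : 0 < x / sqrt 2) by (apply Rdiv_lt_0_compat; lra).
  destruct (gint_tail _ Hp) as [T1 T2].
  assert (Hpi : 2 < PI) by (pose proof PI2_3_2; unfold PI2 in *; lra).
  assert (Hs : sqrt 2 < sqrt PI) by (apply sqrt_lt_1; lra).
  set (g := gint (x / sqrt 2)) in *.
  replace (1 / 2 + - g / sqrt PI) with ((sqrt PI / 2 - g) / sqrt PI) by (field; lra).
  split.
  - apply Rdiv_le_0_compat; lra.
  - replace (1 / (x / sqrt 2)) with (sqrt 2 / x) in T1 by (field; lra).
    apply Rle_div_l; [easy|].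
    apply Rle_trans with (sqrt 2 / x); [lra|].
    unfold Rdiv. rewrite Rmult_1_l, Rmult_comm.
    apply Rmult_le_compat_l; [|lra]. apply Rlt_le, Rinv_0_lt_compat; lra.
Qed.

Lemma Phi_opp x : Phi (- x) = 1 - Phi x.
Proof.
  pose proof sqrtPI_pos. pose proof sqrt2_pos. unfold Phi.
  replace (- x / sqrt 2) with (- (x / sqrt 2)) by (field; lra).
  rewrite gint_odd. field. lra.
Qed.

Lemma normal_cdf_Phi s x : 0 < s -> normal_cdf 0 (s ^ 2) x = Phi (x / s).
Proof.
  intros Hs. unfold normal_cdf.
  assert (Hd : forall y, is_derive (fun y => Phi (y / s)) y (normal_density 0 (s ^ 2) y)).
  { intros y. unfold normal_density. pose proof PI_RGT_0.
    rewrite (sqrt_mult (2 * PI) (s ^ 2)) by (try apply pow2_ge_0; lra).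
    rewrite sqrt_pow2 by lra.
    pose proof (sqrt_lt_R0 (2 * PI) ltac:(lra)).
    replace (exp (- (y - 0) ^ 2 / (2 * s ^ 2)) / (sqrt (2 * PI) * s))
      with (/ s * (exp (- (y / s) ^ 2 / 2) / sqrt (2 * PI))).
    - apply (is_derive_comp Phi (fun y => y / s)); [apply is_derive_Phi|].
      auto_derive; [easy|]. field. lra.
    - replace (- (y / s) ^ 2 / 2) with (- (y - 0) ^ 2 / (2 * s ^ 2)) by (field; lra).
      field. lra. }
  assert (Hc : forall y, continuous (normal_density 0 (s ^ 2)) y).
  { intros y. apply (ex_derive_continuous (normal_density 0 (s ^ 2))).
    unfold normal_density. auto_derive. easy. }
  apply (is_RInt_gen_unique (normal_density 0 (s ^ 2))).
  unfold is_RInt_gen. intros P HP.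
  destruct HP as [eps HP].
  unfold filtermapi.
  (* Below $-s/\varepsilon$, [Phi_low] bounds the missing mass $\Phi(a/s)$ by $s/(-a) <
     \varepsilon$. *)
  apply (Filter_prod _ _ _ (fun a => a < - (s / eps)) (fun b => b = x)).
  - exists (- (s / eps)). easy.
  - easy.
  - intros a b Ha ->. simpl.
    exists (minus (Phi (x / s)) (Phi (a / s))). split.
    + apply (is_RInt_derive (fun y => Phi (y / s))); intros; [apply Hd|apply Hc].
    + apply HP. destruct eps as [e He]. simpl in *.
      assert (0 < s / e) by (apply Rdiv_lt_0_compat; lra).
      assert (Hp : 0 < - a / s) by (apply Rdiv_lt_0_compat; lra).
      destruct (Phi_low _ Hp) as [H1 H2].
      replace (- (- a / s)) with (a / s) in H1, H2 by (field; lra).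
      assert (1 / (- a / s) < e).
      { apply Rlt_div_l; [easy|]. apply Rmult_lt_reg_r with s; [easy|].
        replace (e * (- a / s) * s) with (e * - a) by (field; lra).
        replace (1 * s) with (e * (s / e)) by (field; lra).
        apply Rmult_lt_compat_l; lra. }
      unfold ball; simpl; unfold AbsRing_ball, abs, minus, plus, opp; simpl.
      replace (Phi (x / s) + - Phi (a / s) + - Phi (x / s)) with (- Phi (a / s)) by ring.
      rewrite Rabs_Ropp, Rabs_pos_eq by lra. lra.
Qed.

(** * Concentration of the number of branches of order 2 *)

Lemma psum_telescope (h : nat -> R) k : psum (fun m => h (S m) - h m) k = h k - h O.
Proof.
  induction k as [|k IH]; [unfold psum; simpl; ring|]. rewrite psum_S, IH. ring.
Qed.

(** Summation by parts of the recurrence, a Stein identity for the law: the telescoping quantity [h]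
    vanishes at both ends, at $n+1$ because the law does. *)
Lemma prune_law_stein n (f : nat -> R) :
  psum (fun m => prune_law n m * ((INR n - 2 * INR m) * (INR n - 2 * INR m - 1) * f (S m)
                          - 4 * INR m * (INR m - 1) * f m)) (S n) = 0.
Proof.
  set (h := fun m => 4 * INR m * (INR m - 1) * prune_law n m * f m).
  transitivity (psum (fun m => h (S m) - h m) (S n)).
  - apply lsum_ext_in; intros m _. unfold h. pose proof (prune_law_rec n m) as H.
    rewrite S_INR.
    replace (4 * (INR m + 1) * (INR m + 1 - 1) * prune_law n (S m) * f (S m))
      with (4 * INR m * (INR m + 1) * prune_law n (S m) * f (S m)) by ring.
    rewrite H. ring.
  - rewrite psum_telescope. unfold h. rewrite (prune_law_low n (S n)) by lia. simpl. ring.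
Qed.

(** The quadratic parts of the two Stein coefficients combine into a restoring drift:
    $(N-2m)(N-2m-1) - 4m(m-1) = -4N(m-N/4) + (6m-N)$. Testing with $f(m) = m - N/4$ gives $4N$ times
    the variance, up to terms of at most $\frac32 N^2$ on the support $2m \le N$. *)
Lemma prune_law_variance n : (2 <= n)%nat ->
  psum (fun m => prune_law n m * (INR m - INR n / 4) ^ 2) (S n) <= INR n.
Proof.
  intros Hn. set (N := INR n).
  assert (HN : 2 <= N) by (apply (le_INR 2); lia).
  pose proof (prune_law_stein n (fun m => INR m - N / 4)) as HS. cbv beta in HS. fold N in HS.
  set (c := fun m => prune_law n m * ((N - 2 * INR m) * (N - 2 * INR m - 1) * (INR (S m) - N / 4)
                          - 4 * INR m * (INR m - 1) * (INR m - N / 4))) in HS.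
  assert (H : psum (fun m => 4 * N * (prune_law n m * (INR m - N / 4) ^ 2)) (S n)
           <= psum (fun m => 3 / 2 * N ^ 2 * prune_law n m + (-1) * c m) (S n)).
  { apply lsum_le_in; intros m _.
    destruct (Nat.lt_ge_cases n (2 * m)) as [Hlt|Hge].
    - unfold c. rewrite (prune_law_low n m Hlt). lra.
    - assert (Hm : 2 * INR m <= N).
      { apply le_INR in Hge. rewrite mult_INR in Hge. exact Hge. }
      pose proof (pos_INR m). pose proof (prune_law_nonneg n m ltac:(lia)).
      unfold c. rewrite S_INR.
      set (x := INR m) in *.
      assert (Hk : 4 * N * (x - N / 4) ^ 2 <= 3 / 2 * N ^ 2
        - ((N - 2 * x) * (N - 2 * x - 1) * (x + 1 - N / 4) - 4 * x * (x - 1) * (x - N / 4))).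
      { assert ((N - 2 * x) * (N - 2 * x - 1) <= N * N) by nra.
        assert ((6 * x - N) * (x - N / 4) <= N * N / 2) by nra.
        replace ((N - 2 * x) * (N - 2 * x - 1) * (x + 1 - N / 4) - 4 * x * (x - 1) * (x - N / 4))
          with ((N - 2 * x) * (N - 2 * x - 1) + (6 * x - N) * (x - N / 4) - 4 * N * (x - N / 4) ^ 2)
          by field.
        lra. }
      apply (Rmult_le_compat_l (prune_law n m)) in Hk; [|easy]. lra. }
  unfold psum in H, HS. rewrite lsum_plus, !lsum_scal in H.
  fold (psum (prune_law n) (S n)) in H. rewrite (prune_law_total n Hn) in H.
  rewrite HS in H. unfold psum. set (V := lsum _ _) in *.
  apply (Rmult_le_reg_l (4 * N)); [lra|]. nra.
Qed.

(** Chebyshev's inequality in averaged form: a single majorant handles a small error near the mean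
    and a bounded error far from it. *)
Lemma prune_law_average_bound n (f : nat -> R) (a b : R) : (2 <= n)%nat -> 0 < b ->
  (forall m, Rabs (f m) <= a + b * (INR m - INR n / 4) ^ 2) ->
  Rabs (psum (fun m => prune_law n m * f m) (S n)) <= a + b * INR n.
Proof.
  intros Hn Hb Hf.
  assert (H : psum (fun m => prune_law n m * (a + b * (INR m - INR n / 4) ^ 2)) (S n) <= a + b * INR n).
  { unfold psum.
    rewrite (lsum_ext_in _ (fun m => a * prune_law n m + b * (prune_law n m * (INR m - INR n / 4) ^ 2)))
      by (intros; ring).
    rewrite lsum_plus, !lsum_scal. fold (psum (prune_law n) (S n)). rewrite (prune_law_total n Hn).
    pose proof (prune_law_variance n Hn) as Hv. unfold psum in Hv.
    apply (Rmult_le_compat_l b) in Hv; lra. }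
  apply Rabs_le. split.
  - apply Rle_trans with (-1 * psum (fun m => prune_law n m * (a + b * (INR m - INR n / 4) ^ 2)) (S n)).
    { lra. }
    unfold psum. rewrite <- lsum_scal. apply lsum_le_in; intros m _.
    pose proof (prune_law_nonneg n m ltac:(lia)). specialize (Hf m). apply Rabs_le_between in Hf. nra.
  - eapply Rle_trans; [|exact H]. apply lsum_le_in; intros m _.
    apply Rmult_le_compat_l; [apply prune_law_nonneg; lia|].
    specialize (Hf m). apply Rabs_le_between in Hf. lra.
Qed.

Lemma sqrt_INR_eventually (A : R) : eventually (fun n => A <= sqrt (INR n)).
Proof.
  destruct (INR_unbounded (A ^ 2)) as [n0 H0]. exists n0. intros n Hn.
  apply Rle_trans with (Rabs A); [apply Rle_abs|].
  rewrite <- sqrt_Rsqr_abs. apply sqrt_le_1_alt. rewrite Rsqr_pow2.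
  apply le_INR in Hn. lra.
Qed.

Lemma sqrt_INR_sqr n : sqrt (INR n) * sqrt (INR n) = INR n.
Proof. apply sqrt_sqrt, pos_INR. Qed.

(* Since [m / n] concentrates at [1/4], mixing the laws [F m] rescaled by [sqrt (m / n)]
   rescales the limit law by [1/2]. *)
Lemma mixture_limit (F : nat -> R -> R) (G : R -> R) (x : R) :
  (forall m y, 0 <= F m y <= 1) ->
  (forall m y z, y <= z -> F m y <= F m z) ->
  (forall y, is_lim_seq (fun m => F m y) (G y)) ->
  continuous G (x / 2) ->
  is_lim_seq (fun n => psum (fun m => prune_law n m * F m (x * sqrt (INR m / INR n))) (S n)) (G (x / 2)).
Proof.
  intros HF Hmon Hlim Hcont. apply is_lim_seq_spec. intros [eps Heps]. simpl.
  assert (HG : forall y, 0 <= G y <= 1).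
  { intros y. split.
    - apply (is_lim_seq_le (fun _ => 0) (fun m => F m y) 0 (G y)); auto.
      + intros m; apply HF.
      + apply is_lim_seq_const.
    - apply (is_lim_seq_le (fun m => F m y) (fun _ => 1) (G y) 1); auto.
      + intros m; apply HF.
      + apply is_lim_seq_const. }
  set (e := eps / 4). assert (He : 0 < e) by (unfold e; lra).
  destruct (proj1 (filterlim_locally _ _) Hcont (mkposreal e He)) as [[d Hd] HGd].
  simpl in HGd.
  assert (HGd' : forall y, Rabs (y - x / 2) < d -> Rabs (G y - G (x / 2)) < e) by exact HGd.
  (* The threshold varies with $m$, but monotonicity will enclose it between the fixed points $x/2
     \pm d/2$, where pointwise convergence applies. *)
  pose proof (proj2 (is_lim_seq_spec _ _) (Hlim (x / 2 - d / 2)) (mkposreal e He)) as [N1 HN1].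
  pose proof (proj2 (is_lim_seq_spec _ _) (Hlim (x / 2 + d / 2)) (mkposreal e He)) as [N2 HN2].
  simpl in HN1, HN2.
  (* Chosen so that the mass $1/K^2$ outside the window $|m-n/4| < K\sqrt n$ is below [e]. *)
  set (K := 1 + / e).
  assert (Hie : 0 < / e) by now apply Rinv_0_lt_compat.
  assert (HK : / (K ^ 2) < e).
  { rewrite <- (Rinv_inv e). apply Rinv_lt_contravar; unfold K; nra. }
  assert (HK1 : 1 <= K) by (unfold K; lra).
  set (M := INR (N1 + N2)). pose proof (pos_INR (N1 + N2)) as HM. fold M in HM.
  pose proof (Rabs_pos x) as Hx.
  assert (Hq : 0 <= 4 * K * Rabs x / d) by (apply Rdiv_le_0_compat; nra).
  (* The terms in [K] and [M] keep every $m$ of the window above both [N1] and [N2]; the term in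
     $|x|/d$ keeps the rescaled threshold within $d/2$ of $x/2$. *)
  destruct (sqrt_INR_eventually (8 * K + 8 * M + 4 * K * Rabs x / d + 2)) as [n0 Hn0].
  exists n0. intros n Hn. specialize (Hn0 n Hn). clear Hn.
  pose proof (sqrt_INR_sqr n) as Hsq. set (s := sqrt (INR n)) in *.
  assert (Hn2 : (2 <= n)%nat).
  { apply INR_le. simpl. rewrite <- Hsq. nra. }
  assert (HnP : 0 < INR n) by (apply lt_0_INR; lia).
  set (f := fun m => F m (x * sqrt (INR m / INR n)) - G (x / 2)).
  replace (psum (fun m => prune_law n m * F m (x * sqrt (INR m / INR n))) (S n) - G (x / 2))
    with (psum (fun m => prune_law n m * f m) (S n)).
  2:{ unfold psum, f.
      rewrite (lsum_ext_in _ (fun m => prune_law n m * F m (x * sqrt (INR m / INR n)) + (- G (x / 2)) * prune_law n m))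
        by (intros; ring).
      rewrite lsum_plus, lsum_scal. fold (psum (prune_law n) (S n)). rewrite prune_law_total by easy. ring. }
  apply Rle_lt_trans with (2 * e + (/ K ^ 2 * / INR n) * INR n).
  2:{ rewrite Rmult_assoc, Rinv_l by lra. unfold e in *. lra. }
  assert (HKi : 0 < / K ^ 2) by (apply Rinv_0_lt_compat, pow_lt; lra).
  apply prune_law_average_bound; [easy| |].
  { apply Rmult_lt_0_compat; [easy|]. now apply Rinv_0_lt_compat. }
  intros m. unfold f.
  destruct (Rle_lt_dec (K * s) (Rabs (INR m - INR n / 4))) as [Hout|Hin].
  - apply Rle_trans with 1.
    + apply Rabs_le. pose proof (HF m (x * sqrt (INR m / INR n))). pose proof (HG (x / 2)). lra.
    + assert (1 <= / K ^ 2 * / INR n * (INR m - INR n / 4) ^ 2); [|lra].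
      assert (HKn : 0 < K ^ 2 * INR n) by (apply Rmult_lt_0_compat; [apply pow_lt; lra|easy]).
      rewrite <- Rinv_mult. apply (Rmult_le_reg_l (K ^ 2 * INR n)); [easy|].
      rewrite <- Rmult_assoc, Rinv_r, Rmult_1_l, Rmult_1_r by lra.
      rewrite <- (pow2_abs (INR m - _)).
      replace (K ^ 2 * INR n) with ((K * s) ^ 2) by (rewrite <- Hsq; ring).
      apply pow_incr. split; [nra|easy].
  - apply Rle_trans with (2 * e).
    2:{ assert (0 <= / K ^ 2 * / INR n * (INR m - INR n / 4) ^ 2); [|lra].
        apply Rmult_le_pos; [|apply pow2_ge_0].
        apply Rlt_le, Rmult_lt_0_compat; [easy|]. now apply Rinv_0_lt_compat. }
    apply Rabs_lt_between in Hin.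
    assert (HmM : M <= INR m) by nra.
    apply INR_le in HmM. specialize (HN1 m ltac:(lia)). specialize (HN2 m ltac:(lia)).
    assert (Hroot : Rabs (sqrt (INR m / INR n) - 1 / 2) <= 2 * K / s).
    { set (r := sqrt (INR m / INR n)).
      assert (Hr0 : 0 <= r) by apply sqrt_pos.
      assert (Hr : r * r = INR m / INR n).
      { apply sqrt_sqrt. apply Rdiv_le_0_compat; [apply pos_INR|easy]. }
      assert (Hd1 : - (K / s) <= r * r - 1 / 4 <= K / s).
      { rewrite Hr.
        replace (INR m / INR n - 1 / 4) with ((INR m - INR n / 4) / INR n) by (field; lra).
        replace (K / s) with (K * s / INR n) by (rewrite <- Hsq; field; lra).
        split.
        - replace (- (K * s / INR n)) with (- (K * s) / INR n) by (field; lra).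
          apply Rmult_le_compat_r; [apply Rlt_le, Rinv_0_lt_compat; lra|lra].
        - apply Rmult_le_compat_r; [apply Rlt_le, Rinv_0_lt_compat; lra|lra]. }
      replace (2 * K / s) with (2 * (K / s)) by (field; lra).
      (* Here $r^2 - 1/4 = (r-1/2)(r+1/2)$ and $r + 1/2 \ge 1/2$. *)
      apply Rabs_le. split; nra. }
    assert (Hclose : Rabs (x * sqrt (INR m / INR n) - x / 2) <= d / 2).
    { replace (x * sqrt (INR m / INR n) - x / 2)
        with (x * (sqrt (INR m / INR n) - 1 / 2)) by field.
      rewrite Rabs_mult.
      apply Rle_trans with (Rabs x * (2 * K / s)); [now apply Rmult_le_compat_l|].
      replace (Rabs x * (2 * K / s)) with ((4 * K * Rabs x / d) * (d / 2) / s) by (field; lra).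
      apply Rle_div_l; [lra|]. nra. }
    apply Rabs_le_between in Hclose.
    pose proof (HGd' (x / 2 - d / 2)
      ltac:(replace (x / 2 - d / 2 - x / 2) with (- (d / 2)) by ring;
            rewrite Rabs_Ropp, Rabs_pos_eq; lra)) as HG1.
    pose proof (HGd' (x / 2 + d / 2)
      ltac:(replace (x / 2 + d / 2 - x / 2) with (d / 2) by ring;
            rewrite Rabs_pos_eq; lra)) as HG2.
    pose proof (Hmon m (x / 2 - d / 2) (x * sqrt (INR m / INR n)) ltac:(lra)).
    pose proof (Hmon m (x * sqrt (INR m / INR n)) (x / 2 + d / 2) ltac:(lra)).
    apply Rabs_lt_between in HN1, HN2, HG1, HG2. apply Rabs_le. lra.
Qed.

(** * Comparison with the Gaussian density near the mean *)

(* The density of [N(0, 1/16)], the derivative of [Phi (4 s)]. *)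
Definition g16 (s : R) : R := 4 * (exp (- (4 * s) ^ 2 / 2) / sqrt (2 * PI)).

Lemma sqrt_2PI_ge_1 : 1 <= sqrt (2 * PI).
Proof.
  rewrite <- sqrt_1. apply sqrt_le_1_alt. pose proof PI2_3_2. unfold PI2 in *. lra.
Qed.

Lemma g16_pos s : 0 < g16 s.
Proof.
  pose proof sqrt_2PI_ge_1. unfold g16.
  apply Rmult_lt_0_compat; [lra|]. apply Rdiv_lt_0_compat; [apply exp_pos|lra].
Qed.

Lemma is_derive_Phi4 (s : R) : is_derive (fun s => Phi (4 * s)) s (g16 s).
Proof.
  unfold g16. apply (is_derive_comp Phi (fun s => 4 * s)); [apply is_derive_Phi|].
  auto_derive; [easy|]. ring.
Qed.

Lemma is_derive_g16 (s : R) : is_derive g16 s (- 16 * s * g16 s).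
Proof.
  pose proof sqrt_2PI_ge_1. unfold g16.
  auto_derive; [easy|].
  replace (- (4 * s * (4 * s * 1)) * / 2) with (- (4 * s) ^ 2 / 2) by field.
  set (E := exp _). field. lra.
Qed.

(** Both bounds, on the density and on its derivative, follow from $g(s)(1+8s^2) \le 4$, a
    consequence of $e^u \ge 1+u$. *)
Lemma g16_bounds s : g16 s <= 4 /\ Rabs (- 16 * s * g16 s) <= 64.
Proof.
  pose proof sqrt_2PI_ge_1. pose proof (g16_pos s).
  assert (Hb : g16 s * (1 + 8 * s ^ 2) <= 4).
  { unfold g16. replace (- (4 * s) ^ 2 / 2) with (- (8 * s ^ 2)) by field.
    rewrite exp_Ropp. pose proof (exp_ineq1_le (8 * s ^ 2)).
    pose proof (exp_pos (8 * s ^ 2)).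
    set (E := exp (8 * s ^ 2)) in *. set (c := sqrt (2 * PI)) in *.
    replace (4 * (/ E / c) * (1 + 8 * s ^ 2)) with (4 * ((1 + 8 * s ^ 2) / (E * c))) by (field; lra).
    assert ((1 + 8 * s ^ 2) / (E * c) <= 1); [|lra].
    apply Rle_div_l; nra. }
  pose proof (pow2_ge_0 s).
  split; [nra|]. apply Rabs_le. split; nra.
Qed.

Lemma mvt_bound (f df : R -> R) (L a b : R) :
  (forall x, is_derive f x (df x)) -> (forall x, Rabs (df x) <= L) ->
  Rabs (f b - f a) <= L * Rabs (b - a).
Proof.
  intros Hd Hb. destruct (MVT_gen f a b df) as [c [_ ->]].
  - intros; apply Hd.
  - intros x _. apply continuity_pt_filterlim, (ex_derive_continuous f). eexists; apply Hd.
  - rewrite Rabs_mult. apply Rmult_le_compat_r; [apply Rabs_pos|apply Hb].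
Qed.

Lemma Phi4_lipschitz a b : Rabs (Phi (4 * b) - Phi (4 * a)) <= 4 * Rabs (b - a).
Proof.
  apply (mvt_bound (fun s => Phi (4 * s)) g16); [apply is_derive_Phi4|].
  intros x. rewrite Rabs_pos_eq by apply Rlt_le, g16_pos. apply g16_bounds.
Qed.

Lemma riemann_step s h : 0 < h ->
  Rabs (h * g16 s - (Phi (4 * (s + h)) - Phi (4 * s))) <= 64 * h ^ 2.
Proof.
  intros Hh. destruct (MVT_gen (fun s => Phi (4 * s)) s (s + h) g16) as [c [Hc ->]].
  - intros; apply is_derive_Phi4.
  - intros x _. apply continuity_pt_filterlim, (ex_derive_continuous (fun s => Phi (4 * s))).
    eexists; apply is_derive_Phi4.
  - rewrite Rmin_left, Rmax_right in Hc by lra.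
    replace (h * g16 s - g16 c * (s + h - s)) with (h * (g16 s - g16 c)) by ring.
    rewrite Rabs_mult, Rabs_pos_eq by lra.
    replace (64 * h ^ 2) with (h * (64 * h)) by ring.
    apply Rmult_le_compat_l; [lra|].
    apply Rle_trans with (64 * Rabs (s - c)).
    + apply (mvt_bound g16 (fun s => - 16 * s * g16 s)); [apply is_derive_g16|].
      intros x. apply g16_bounds.
    + apply Rmult_le_compat_l; [lra|]. apply Rabs_le. lra.
Qed.

Lemma riemann_sum (s : nat -> R) h a k : 0 < h -> (forall m, s (S m) = s m + h) ->
  Rabs (h * lsum (fun m => g16 (s m)) (seq a k) - (Phi (4 * s (a + k)%nat) - Phi (4 * s a)))
  <= INR k * (64 * h ^ 2).
Proof.
  intros Hh Hs. induction k as [|k IH].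
  - rewrite Nat.add_0_r. simpl.
    replace (h * 0 - (Phi (4 * s a) - Phi (4 * s a))) with 0 by ring. rewrite Rabs_R0. lra.
  - rewrite seq_S, lsum_app, Nat.add_succ_r, Hs, S_INR. simpl.
    pose proof (riemann_step (s (a + k)%nat) h Hh).
    apply Rabs_le_between in IH, H. apply Rabs_le. simpl in *. lra.
Qed.

(** The upper bound comes from $e^{-u} \ge 1-u$ and $(1+u+2u^2)(1-u) = 1 + u^2(1-2u) \ge 1$. *)
Lemma exp_quadratic e : Rabs e <= 1 / 2 -> 1 + e <= exp e <= 1 + e + 2 * e ^ 2.
Proof.
  intros He. apply Rabs_le_between in He. split; [apply exp_ineq1_le|].
  pose proof (exp_ineq1_le (- e)) as H. rewrite exp_Ropp in H.
  pose proof (exp_pos e) as Hp.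
  assert (H1 : exp e * (1 - e) <= 1).
  { apply Rle_trans with (exp e * / exp e); [apply Rmult_le_compat_l; lra|].
    rewrite Rinv_r; lra. }
  assert (H2 : 1 <= (1 + e + 2 * e ^ 2) * (1 - e)) by nra.
  apply (Rmult_le_reg_r (1 - e)); lra.
Qed.

(* With [x = (m - n/4) / n] and [t = 1/n], the ratio [prune_law n (m+1) / prune_law n m] is
   [(1-4x)(1-4x-2t) / ((1+4x)(1+4x+4t))], and [exp (-16x - 8t)] is the Gaussian ratio. *)
Lemma ratio_bound x t : Rabs x <= 1 / 64 -> 0 < t <= 1 / 32 ->
  let A := (1 - 4 * x) * (1 - 4 * x - 2 * t) in
  let B := (1 + 4 * x) * (1 + 4 * x + 4 * t) in
  0 < B /\ Rabs (A * exp (16 * x + 8 * t) - B) <= (42 * t + 4400 * x ^ 2) * B.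
Proof.
  intros Hx Ht A B. apply Rabs_le_between in Hx.
  set (e := 16 * x + 8 * t).
  assert (He : Rabs e <= 1 / 2) by (apply Rabs_le; unfold e; lra).
  destruct (exp_quadratic e He) as [E1 E2]. apply Rabs_le_between in He.
  assert (HB : 1 / 2 <= B) by (unfold B; nra).
  assert (HA : 0 <= A <= 2) by (unfold A; nra).
  split; [lra|].
  (* The terms linear in $x$ cancel: the ratios agree up to order $t + x^2$. *)
  assert (HM : A * (1 + e) - B =
    2 * t - 104 * (x * t) - 128 * x ^ 2 - 16 * t ^ 2 + (16 * x ^ 2 + 8 * (x * t)) * e).
  { unfold A, B, e. ring. }
  assert (Hxt : - (t / 64) <= x * t <= t / 64) by nra.
  assert (Htt : 0 <= t ^ 2 <= t / 32) by nra.
  pose proof (pow2_ge_0 x) as Hxx.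
  assert (Hlast : - (8 * x ^ 2 + t / 16) <= (16 * x ^ 2 + 8 * (x * t)) * e <= 8 * x ^ 2 + t / 16).
  { apply Rabs_le_between. rewrite Rabs_mult.
    apply Rle_trans with ((16 * x ^ 2 + t / 8) * (1 / 2)); [|lra].
    apply Rmult_le_compat; try apply Rabs_pos; apply Rabs_le; lra. }
  assert (Hm : - (5 * t + 140 * x ^ 2) <= A * (1 + e) - B <= 5 * t + 140 * x ^ 2) by lra.
  assert (Hee : e ^ 2 <= 512 * x ^ 2 + 4 * t).
  { unfold e. assert ((16 * x + 8 * t) ^ 2 <= 512 * x ^ 2 + 128 * t ^ 2).
    { pose proof (pow2_ge_0 (16 * x - 8 * t)). lra. }
    lra. }
  pose proof (pow2_ge_0 e).
  assert (HAl : A * (1 + e) <= A * exp e) by (apply Rmult_le_compat_l; lra).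
  assert (HAu : A * exp e <= A * (1 + e) + 4 * e ^ 2).
  { apply Rle_trans with (A * (1 + e + 2 * e ^ 2)); [apply Rmult_le_compat_l; lra|]. nra. }
  (* The errors add up to $5t + 140x^2 + 4e^2 \le 21t + 2188x^2$, and $B \ge 1/2$ doubles the
     constants. *)
  apply Rle_trans with ((42 * t + 4400 * x ^ 2) * (1 / 2)).
  - apply Rabs_le. lra.
  - apply Rmult_le_compat_l; lra.
Qed.

(** The value of the statistic for $r = 1$ on a tree with $n$ leaves and $m$ branches of order 2. *)
Definition dev (n m : nat) : R := (INR m - INR n / 4) / sqrt (INR n).

Lemma dev_S n m : dev n (S m) = dev n m + / sqrt (INR n).
Proof. unfold dev. rewrite S_INR. unfold Rdiv. ring. Qed.

Definition rel (n m : nat) : R := prune_law n m / g16 (dev n m).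

(** On the window $x^2 \le K^2 t$, so this constant times $t = 1/n$ dominates the error of
    [ratio_bound]. *)
Definition ratio_const (K : R) : R := 42 + 4400 * K ^ 2.

(** Each step changes [rel] by a relative amount of order $1/n$, so over a window of order $\sqrt n$
    points it is nearly constant. *)
Lemma rel_step n m K : 1 <= K -> 64 * K <= sqrt (INR n) ->
  Rabs (dev n m) <= K ->
  Rabs (rel n (S m) - rel n m) <= ratio_const K / INR n * rel n m.
Proof.
  intros HK Hn Hdev.
  pose proof (sqrt_INR_sqr n) as Hsq. set (s := sqrt (INR n)) in *.
  set (N := INR n) in *.
  assert (HN : 0 < N) by nra.
  assert (Hn1 : (1 <= n)%nat).
  { destruct n; [|lia]. unfold N in HN. simpl in HN. lra. }
  set (x := dev n m / s). set (t := / N).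
  assert (Hmx : INR m = N / 4 + x * N).
  { assert (E : x * (s * s) = INR m - N / 4).
    { unfold x, dev. fold N. fold s. field. lra. }
    rewrite Hsq in E. lra. }
  assert (Ht : 0 < t <= 1 / 32).
  { split; [now apply Rinv_0_lt_compat|]. unfold t.
    replace (1 / 32) with (/ 32) by field. apply Rinv_le_contravar; nra. }
  assert (Hx : Rabs x <= 1 / 64).
  { unfold x, Rdiv. rewrite Rabs_mult, (Rabs_pos_eq (/ s)).
    2:{ apply Rlt_le, Rinv_0_lt_compat. lra. }
    apply Rle_div_l; [lra|]. lra. }
  assert (Hx2 : x ^ 2 <= K ^ 2 * t).
  { unfold x, t. rewrite <- Hsq.
    replace ((dev n m / s) ^ 2) with (dev n m ^ 2 * / (s * s)) by (field; lra).
    apply Rmult_le_compat_r.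
    - apply Rlt_le, Rinv_0_lt_compat. nra.
    - rewrite <- (pow2_abs (dev n m)). apply pow_incr. split; [apply Rabs_pos|easy]. }
  destruct (ratio_bound x t Hx Ht) as [HB HR].
  set (A := (1 - 4 * x) * (1 - 4 * x - 2 * t)) in *.
  set (B := (1 + 4 * x) * (1 + 4 * x + 4 * t)) in *.
  assert (Hw : B * prune_law n (S m) = A * prune_law n m).
  { pose proof (prune_law_rec n m) as H. fold N in H. rewrite Hmx in H.
    replace (4 * (N / 4 + x * N) * (N / 4 + x * N + 1)) with (N ^ 2 / 4 * B) in H
      by (unfold B, t; field; lra).
    replace ((N - 2 * (N / 4 + x * N)) * (N - 2 * (N / 4 + x * N) - 1)) with (N ^ 2 / 4 * A) in H
      by (unfold A, t; field; lra).
    apply (Rmult_eq_reg_l (N ^ 2 / 4)); [lra|]. nra. }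
  (* The exponent is $8(\delta + 1/s)^2 - 8\delta^2 = 16\delta/s + 8/s^2$ with $\delta$ the
     deviation at $m$. *)
  assert (Hg : g16 (dev n m) = exp (16 * x + 8 * t) * g16 (dev n (S m))).
  { unfold g16.
    replace (exp (- (4 * dev n m) ^ 2 / 2))
      with (exp (16 * x + 8 * t) * exp (- (4 * dev n (S m)) ^ 2 / 2)).
    { pose proof sqrt_2PI_ge_1. field. lra. }
    rewrite <- exp_plus. f_equal. rewrite dev_S. unfold x, t. fold N. fold s. rewrite <- Hsq.
    field. lra. }
  pose proof (g16_pos (dev n m)) as P1. pose proof (g16_pos (dev n (S m))) as P2.
  pose proof (prune_law_nonneg n m Hn1) as P3.
  assert (Hr : B * (rel n (S m) - rel n m) = (A * exp (16 * x + 8 * t) - B) * rel n m).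
  { unfold rel. rewrite Hg. pose proof (exp_pos (16 * x + 8 * t)).
    replace (B * (prune_law n (S m) / g16 (dev n (S m)) - prune_law n m / (exp (16 * x + 8 * t) * g16 (dev n (S m)))))
      with ((B * prune_law n (S m)) / g16 (dev n (S m))
            - B * prune_law n m / (exp (16 * x + 8 * t) * g16 (dev n (S m)))) by (field; lra).
    rewrite Hw. field. lra. }
  assert (P4 : 0 <= rel n m) by now apply Rdiv_le_0_compat.
  apply (Rmult_le_reg_l B); [easy|].
  rewrite <- (Rabs_pos_eq B) at 1 by lra. rewrite <- Rabs_mult, Hr, Rabs_mult.
  rewrite (Rabs_pos_eq (rel n m)) by easy.
  rewrite <- Rmult_assoc. apply Rmult_le_compat_r; [easy|].
  eapply Rle_trans; [exact HR|]. rewrite Rmult_comm.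
  apply Rmult_le_compat_l; [lra|]. unfold ratio_const, Rdiv. fold t. lra.
Qed.

(** A linear, two-sided discrete Gronwall inequality, resting on $(1-d)(1-jd) \ge 1-(j+1)d$ and
    $(1-(j+1)d)(1+d) \le 1-jd$. *)
Lemma gronwall (u : nat -> R) (d : R) a j :
  0 <= d -> INR j * d <= 1 -> (forall m, 0 <= u m) ->
  (forall m, (a <= m < a + j)%nat -> Rabs (u (S m) - u m) <= d * u m) ->
  (1 - INR j * d) * u a <= u (a + j)%nat /\ (1 - INR j * d) * u (a + j)%nat <= u a.
Proof.
  intros Hd. induction j as [|j IH]; intros Hj Hu Hs.
  - rewrite Nat.add_0_r. simpl. pose proof (Hu a). lra.
  - rewrite S_INR in *.
    destruct IH as [I1 I2]; [lra|easy|intros; apply Hs; lia|].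
    specialize (Hs (a + j)%nat ltac:(lia)). apply Rabs_le_between in Hs.
    rewrite Nat.add_succ_r.
    pose proof (Hu (a + j)%nat). pose proof (Hu a). pose proof (Hu (S (a + j))).
    pose proof (pos_INR j).
    set (v := u (a + j)%nat) in *. set (v' := u (S (a + j))) in *. set (k := INR j) in *.
    split.
    + assert (d <= 1) by nra.
      apply Rle_trans with ((1 - d) * ((1 - k * d) * u a)).
      * assert (0 <= k * d * d * u a) by (repeat apply Rmult_le_pos; easy). nra.
      * apply Rle_trans with ((1 - d) * v); [apply Rmult_le_compat_l; lra|lra].
    + apply Rle_trans with ((1 - (k + 1) * d) * ((1 + d) * v)).
      * apply Rmult_le_compat_l; lra.
      * eapply Rle_trans; [|exact I2].
        assert (0 <= (k + 1) * d * d * v) by (repeat apply Rmult_le_pos; lra). nra.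
Qed.

(** * The central limit theorem for branches of order 2 *)

(* The number of integers [m >= 0] with [dev n m <= y]. *)
Definition idx (n : nat) (y : R) : nat := Z.to_nat (up (INR n / 4 + y * sqrt (INR n))).

(** The second hypothesis makes $n/4 + y\sqrt n$ nonnegative, so that [Z.to_nat] does not
    truncate. *)
Lemma idx_spec n y : 0 < sqrt (INR n) -> - y <= sqrt (INR n) / 4 ->
  (forall m, (m < idx n y)%nat <-> dev n m <= y) /\
  y < dev n (idx n y) <= y + / sqrt (INR n).
Proof.
  intros Hs Hy. pose proof (sqrt_INR_sqr n) as Hsq.
  unfold dev, idx. set (s := sqrt (INR n)) in *. set (r := INR n / 4 + y * s).
  assert (Hr : 0 <= r) by (unfold r; nra).
  destruct (archimed r) as [H1 H2].
  assert (Hz : (0 < up r)%Z) by (apply lt_IZR; lra).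
  assert (Hi : INR (Z.to_nat (up r)) = IZR (up r)) by (rewrite INR_IZR_INZ, Z2Nat.id; [easy|lia]).
  split.
  - intros m. rewrite Rle_div_l by lra. split; intros H.
    + assert (Hm : (Z.of_nat m <= up r - 1)%Z) by lia.
      apply IZR_le in Hm. rewrite minus_IZR, <- INR_IZR_INZ in Hm. unfold r in *. lra.
    + apply INR_lt. rewrite Hi. unfold r in *. lra.
  - rewrite Hi. split.
    + apply Rlt_div_r; [lra|]. unfold r in *. lra.
    + apply Rle_div_l; [lra|]. rewrite Rmult_plus_distr_r, Rinv_l by lra. unfold r in *. lra.
Qed.

Lemma psum_cut (f : nat -> R) k l : (k <= l)%nat ->
  psum (fun m => f m * b2r (m <? k)%nat) l = psum f k.
Proof.
  intros Hkl. replace l with (k + (l - k))%nat by lia. unfold psum.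
  rewrite seq_app, lsum_app. simpl.
  rewrite (lsum_ext_in _ f (seq 0 k)), (lsum_ext_in _ (fun _ => 0) (seq k _)), lsum_const.
  - ring.
  - intros m Hm. apply in_seq in Hm. unfold b2r. destruct (Nat.ltb_spec m k); [lia|ring].
  - intros m Hm. apply in_seq in Hm. unfold b2r. destruct (Nat.ltb_spec m k); [ring|lia].
Qed.

Lemma psum_range (f : nat -> R) a c : (a <= c)%nat -> lsum f (seq a (c - a)) = psum f c - psum f a.
Proof.
  intros H. replace c with (a + (c - a))%nat at 2 by lia. unfold psum.
  rewrite seq_app, lsum_app. simpl. ring.
Qed.

Lemma prune_law_tail n K (f : nat -> bool) : (2 <= n)%nat -> 0 < K ->
  (forall m, f m = true -> K <= Rabs (dev n m)) ->
  psum (fun m => prune_law n m * b2r (f m)) (S n) <= / K ^ 2.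
Proof.
  intros Hn HK Hf.
  assert (HN : 0 < INR n) by (apply lt_0_INR; lia).
  assert (HK2 : 0 < K ^ 2) by (now apply pow_lt).
  pose proof (sqrt_INR_sqr n) as Hsq. pose proof (sqrt_lt_R0 _ HN) as Hs.
  assert (Hb : 0 < / (K ^ 2 * INR n)) by (apply Rinv_0_lt_compat, Rmult_lt_0_compat; easy).
  eapply Rle_trans; [apply Rle_abs|].
  replace (/ K ^ 2) with (0 + / (K ^ 2 * INR n) * INR n) by (field; lra).
  apply prune_law_average_bound; [easy|easy|]. intros m.
  assert (H0 : 0 <= / (K ^ 2 * INR n) * (INR m - INR n / 4) ^ 2).
  { apply Rmult_le_pos; [lra|apply pow2_ge_0]. }
  unfold b2r. destruct (f m) eqn:E; [|rewrite Rabs_R0; lra].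
  rewrite Rabs_R1. apply Hf in E.
  replace (/ (K ^ 2 * INR n) * (INR m - INR n / 4) ^ 2) with (Rabs (dev n m) ^ 2 / K ^ 2).
  - assert (1 <= Rabs (dev n m) ^ 2 / K ^ 2); [|lra].
    apply Rle_div_r; [easy|]. rewrite Rmult_1_l. apply pow_incr. lra.
  - rewrite pow2_abs. unfold dev. rewrite <- Hsq at 3. field. lra.
Qed.

(** Both masses are nearly proportional to Gaussian masses with the same unknown factor [v];
    cross-multiplication eliminates it. *)
Lemma cross_bound A B G1 G2 v e : 0 <= e <= 1 -> 0 <= A <= 1 -> 0 <= B <= 1 ->
  0 <= G1 <= 2 -> 0 <= G2 <= 2 ->
  (1 - e) * A <= v * G1 -> (1 - e) * (v * G1) <= A ->
  (1 - e) * B <= v * G2 -> (1 - e) * (v * G2) <= B ->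
  Rabs (A * G2 - B * G1) <= 4 * e.
Proof.
  intros He HA HB HG1 HG2 H1 H2 H3 H4.
  assert (C : forall A B G1 G2, 0 <= A <= 1 -> 0 <= G1 -> 0 <= G2 <= 2 ->
    (1 - e) * A <= v * G1 -> (1 - e) * (v * G2) <= B -> A * G2 - B * G1 <= 4 * e).
  { clear - He. intros A B G1 G2 HA HG1 HG2 H1 H4.
    assert (I1 : (1 - e) * ((1 - e) * A * G2) <= (1 - e) * (v * G1 * G2)).
    { apply Rmult_le_compat_l; [lra|]. apply Rmult_le_compat_r; lra. }
    assert (I2 : (1 - e) * (v * G2) * G1 <= B * G1) by (apply Rmult_le_compat_r; lra).
    assert (I3 : 0 <= A * G2 <= 2) by nra.
    apply Rle_trans with (A * G2 * (2 * e)); [|nra].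
    assert (0 <= e * e * (A * G2)) by (repeat apply Rmult_le_pos; lra). lra. }
  apply Rabs_le. split.
  - pose proof (C B A G2 G1 HB ltac:(lra) HG1 H3 H2). lra.
  - apply C; easy.
Qed.

(** On the window the law is nearly [rel n a] times the Gaussian density. The witness [G] is the
    Riemann sum of that density with mesh $1/\sqrt n$, and the normalising factor [v] is left
    undetermined. *)
Lemma window_compare n K z :
  1 <= K -> 64 * K <= sqrt (INR n) -> 3 * K * ratio_const K <= sqrt (INR n) -> - K <= z <= K ->
  let s := sqrt (INR n) in
  let e := 3 * K * ratio_const K / s in
  let a := idx n (- K) in
  let W := psum (prune_law n) (idx n z) - psum (prune_law n) a in
  let v := rel n a * s in
  exists G, 0 <= G /\ Rabs (G - (Phi (4 * z) - Phi (4 * - K))) <= 200 * K / s /\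
    (1 - e) * W <= v * G /\ (1 - e) * (v * G) <= W.
Proof.
  intros HK Hs HsC Hz s e a W v. set (c := idx n z).
  fold s in Hs, HsC. pose proof (sqrt_INR_sqr n) as Hsq. fold s in Hsq.
  assert (HN : 0 < INR n) by nra.
  assert (Hn1 : (1 <= n)%nat) by (apply (INR_lt 0) in HN; lia).
  assert (HC : 42 <= ratio_const K) by (unfold ratio_const; nra).
  destruct (idx_spec n (- K) ltac:(fold s; lra) ltac:(fold s; lra)) as [Ia Da].
  destruct (idx_spec n z ltac:(fold s; lra) ltac:(fold s; lra)) as [Ic Dc].
  fold a in Ia, Da. fold c in Ic, Dc. fold s in Da, Dc.
  assert (Hs0 : 0 < / s) by (apply Rinv_0_lt_compat; lra).
  assert (Hac : (a <= c)%nat).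
  { apply Nat.nlt_ge. intros H. apply Ia in H. lra. }
  (* The window has at most $2Ks + 1$ points. *)
  assert (Hlen : INR (c - a) <= 3 * K * s).
  { rewrite minus_INR by easy.
    replace (INR c - INR a) with (s * (dev n c - dev n a)) by (unfold dev; fold s; field; lra).
    apply Rle_trans with (s * (2 * K + / s)).
    - apply Rmult_le_compat_l; lra.
    - rewrite Rmult_plus_distr_l, Rinv_r by lra. nra. }
  set (Sg := lsum (fun m => g16 (dev n m)) (seq a (c - a))).
  assert (HSg : 0 <= Sg).
  { unfold Sg. rewrite <- (Rmult_0_l (INR (length (seq a (c - a))))), <- lsum_const.
    apply lsum_le_in; intros; apply Rlt_le, g16_pos. }
  exists (/ s * Sg).
  assert (Hv : v * (/ s * Sg) = rel n a * Sg) by (unfold v; field; lra).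
  rewrite Hv. unfold W. fold c. rewrite <- psum_range by easy.
  assert (Hrel : forall m, 0 <= rel n m).
  { intros m. apply Rdiv_le_0_compat; [now apply prune_law_nonneg|apply g16_pos]. }
  assert (Hpt : forall m, In m (seq a (c - a)) ->
    (1 - e) * prune_law n m <= rel n a * g16 (dev n m) /\
    (1 - e) * (rel n a * g16 (dev n m)) <= prune_law n m).
  { intros m Hm. apply in_seq in Hm.
    pose proof (g16_pos (dev n m)) as Hg.
    assert (Hj : INR (m - a) * (ratio_const K / INR n) <= e).
    { unfold e. rewrite <- Hsq.
      replace (3 * K * ratio_const K / s) with (3 * K * s * (ratio_const K / (s * s)))
        by (field; lra).
      apply Rmult_le_compat_r.
      - apply Rdiv_le_0_compat; nra.
      - eapply Rle_trans; [|exact Hlen]. apply le_INR. lia. }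
    assert (He1 : e <= 1) by (apply Rle_div_l; lra).
    destruct (gronwall (rel n) (ratio_const K / INR n) a (m - a)) as [G1 G2].
    - apply Rdiv_le_0_compat; lra.
    - lra.
    - easy.
    - intros i Hi. apply rel_step; [easy|exact Hs|].
      assert (~ dev n i <= - K) by (rewrite <- Ia; lia).
      assert (dev n i <= z) by (apply Ic; lia).
      apply Rabs_le. lra.
    - replace (a + (m - a))%nat with m in G1, G2 by lia.
      assert (Hw : prune_law n m = rel n m * g16 (dev n m)) by (unfold rel; field; lra).
      pose proof (Hrel m). pose proof (Hrel a). rewrite Hw. split.
      + rewrite <- Rmult_assoc. apply Rmult_le_compat_r; [lra|]. nra.
      + rewrite <- Rmult_assoc. apply Rmult_le_compat_r; [lra|]. nra. }
  split; [|split; [|split]].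
  - apply Rmult_le_pos; lra.
  - pose proof (riemann_sum (dev n) (/ s) a (c - a) Hs0 (fun m => dev_S n m)) as HR.
    fold Sg in HR. replace (a + (c - a))%nat with c in HR by lia.
    (* The Riemann error is at most $192K/s$; rounding the two endpoints to the lattice costs $4/s$
       each, whence 200. *)
    assert (Herr : INR (c - a) * (64 * (/ s) ^ 2) <= 192 * K / s).
    { replace (192 * K / s) with (3 * K * s * (64 * (/ s) ^ 2)) by (field; lra).
      apply Rmult_le_compat_r; [|easy]. pose proof (pow2_ge_0 (/ s)). lra. }
    pose proof (Phi4_lipschitz z (dev n c)) as L1.
    pose proof (Phi4_lipschitz (- K) (dev n a)) as L2.
    assert (B1 : Rabs (dev n c - z) <= / s) by (apply Rabs_le; lra).
    assert (B2 : Rabs (dev n a - - K) <= / s) by (apply Rabs_le; lra).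
    apply Rabs_le_between in HR.
    assert (M1 : - (4 * / s) <= Phi (4 * dev n c) - Phi (4 * z) <= 4 * / s)
      by (apply Rabs_le_between; lra).
    assert (M2 : - (4 * / s) <= Phi (4 * dev n a) - Phi (4 * - K) <= 4 * / s)
      by (apply Rabs_le_between; lra).
    assert (HKs : / s <= K * / s) by nra.
    unfold Rdiv in *. apply Rabs_le. lra.
  - unfold Sg. rewrite <- !lsum_scal. apply lsum_le_in; intros m Hm. now apply Hpt.
  - unfold Sg. rewrite <- !lsum_scal. apply lsum_le_in; intros m Hm. now apply Hpt.
Qed.

(** The window up to [y] is compared with the one up to [K], whose mass is close to 1 under both
    laws. This fixes the common normalisation, so no asymptotics of Catalan numbers enter. *)
Lemma clt_bound n K y :
  1 <= K -> 64 * K <= sqrt (INR n) -> 3 * K * ratio_const K <= sqrt (INR n) ->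
  200 * K <= sqrt (INR n) -> - K <= y <= K ->
  Rabs (psum (prune_law n) (idx n y) - Phi (4 * y))
  <= 8 / K + (400 * K + 12 * K * ratio_const K) / sqrt (INR n).
Proof.
  intros HK Hs HsC HsK Hy.
  pose proof (window_compare n K y HK Hs HsC Hy) as Wy.
  pose proof (window_compare n K K HK Hs HsC ltac:(lra)) as WK. cbv zeta in Wy, WK.
  set (s := sqrt (INR n)) in *. set (e := 3 * K * ratio_const K / s) in *.
  pose proof (sqrt_INR_sqr n) as Hsq. fold s in Hsq.
  assert (HC : 42 <= ratio_const K) by (unfold ratio_const; nra).
  assert (Hn2 : (2 <= n)%nat) by (apply INR_le; rewrite <- Hsq; simpl; nra).
  destruct Wy as [Gy [Gy0 [Gy1 [Gy2 Gy3]]]]. destruct WK as [GK [GK0 [GK1 [GK2 GK3]]]].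
  set (a := idx n (- K)) in *. set (b := idx n K) in *. set (p := idx n y) in *.
  set (Fa := psum (prune_law n) a) in *. set (Fb := psum (prune_law n) b) in *. set (Fp := psum (prune_law n) p) in *.
  destruct (idx_spec n (- K) ltac:(fold s; lra) ltac:(fold s; lra)) as [Ia Da].
  destruct (idx_spec n y ltac:(fold s; lra) ltac:(fold s; lra)) as [Ip Dp].
  destruct (idx_spec n K ltac:(fold s; lra) ltac:(fold s; lra)) as [Ib Db].
  fold a in Ia, Da. fold p in Ip, Dp. fold b in Ib, Db.
  assert (Hap : (a <= p)%nat).
  { apply Nat.nlt_ge. intros H. apply Ia in H. lra. }
  assert (Hpb : (p <= b)%nat).
  { apply Nat.nlt_ge. intros H. apply Ip in H. lra. }
  assert (Hbn : (b <= S n)%nat).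
  { apply Nat.nlt_ge. intros H. apply Ib in H. unfold dev in H. fold s in H.
    apply Rle_div_l in H; [|lra]. rewrite S_INR in H. nra. }
  assert (Hmono : forall i j, (i <= j)%nat -> psum (prune_law n) i <= psum (prune_law n) j).
  { intros i j Hij. apply Rminus_le_0. rewrite <- psum_range by easy.
    rewrite <- (Rmult_0_l (INR (length (seq i (j - i))))), <- lsum_const.
    apply lsum_le_in; intros; apply prune_law_nonneg; lia. }
  assert (F0 : 0 <= Fa) by (exact (Hmono 0%nat a ltac:(lia))).
  assert (F1 : Fa <= Fp) by now apply Hmono.
  assert (F2 : Fp <= Fb) by now apply Hmono.
  assert (F3 : Fb <= 1) by (rewrite <- (prune_law_total n Hn2); now apply Hmono).
  assert (Ta : Fa <= / K ^ 2).
  { unfold Fa. rewrite <- (psum_cut (prune_law n) a (S n)) by lia.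
    apply prune_law_tail; [easy|lra|]. intros m Hm. apply Nat.ltb_lt, Ia in Hm.
    rewrite Rabs_left1; lra. }
  assert (Tb : 1 - Fb <= / K ^ 2).
  { unfold Fb. rewrite <- (prune_law_total n Hn2), <- (psum_cut (prune_law n) b (S n)) by lia.
    apply Rle_trans with (psum (fun m => prune_law n m * b2r (negb (m <? b)%nat)) (S n)).
    - apply Req_le. unfold Rminus.
      replace (- psum (fun m => prune_law n m * b2r (m <? b)%nat) (S n))
        with (-1 * psum (fun m => prune_law n m * b2r (m <? b)%nat) (S n)) by ring.
      unfold psum. rewrite <- lsum_scal, <- lsum_plus. apply lsum_ext_in; intros m _.
      unfold b2r. destruct (m <? b)%nat; simpl; ring.
    - apply prune_law_tail; [easy|lra|]. intros m Hm.
      assert (~ dev n m <= K).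
      { rewrite <- Ib. destruct (Nat.ltb_spec m b); [easy|lia]. }
      rewrite Rabs_pos_eq; lra. }
  assert (HKi : 0 < / K <= 1).
  { split; [apply Rinv_0_lt_compat; lra|]. rewrite <- Rinv_1. apply Rinv_le_contravar; lra. }
  assert (HK2 : / K ^ 2 <= / K).
  { replace (/ K ^ 2) with (/ K * / K) by (field; lra). nra. }
  assert (P1 : 0 <= Phi (4 * - K) <= / K).
  { replace (4 * - K) with (- (4 * K)) by ring.
    pose proof (Phi_low (4 * K) ltac:(lra)). unfold Rdiv in H. rewrite Rinv_mult in H. lra. }
  assert (P2 : 0 <= 1 - Phi (4 * K) <= / K).
  { rewrite <- Phi_opp. replace (- (4 * K)) with (4 * - K) by ring. easy. }
  assert (He : 0 <= e <= 1).
  { split; [apply Rdiv_le_0_compat; nra|]. apply Rle_div_l; lra. }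
  set (e1 := 200 * K / s) in *.
  assert (He1 : 0 <= e1 <= 1).
  { split; [apply Rdiv_le_0_compat; lra|]. apply Rle_div_l; lra. }
  assert (Hyb : Phi (4 * y) <= Phi (4 * K)).
  { apply Rminus_le_0. destruct (MVT_gen (fun s => Phi (4 * s)) y K g16) as [c [_ ->]].
    - intros; apply is_derive_Phi4.
    - intros x _. apply continuity_pt_filterlim, (ex_derive_continuous (fun s => Phi (4 * s))).
      eexists; apply is_derive_Phi4.
    - pose proof (g16_pos c). nra. }
  apply Rabs_le_between in Gy1, GK1.
  pose proof (cross_bound (Fp - Fa) (Fb - Fa) Gy GK (rel n a * s) e He
    ltac:(lra) ltac:(lra) ltac:(lra) ltac:(lra) Gy2 Gy3 GK2 GK3) as HX.
  apply Rabs_le_between in HX.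
  replace (8 / K + (400 * K + 12 * K * ratio_const K) / s) with (8 * / K + 2 * e1 + 4 * e)
    by (unfold e, e1; field; lra).
  set (A := Fp - Fa) in *. set (B := Fb - Fa) in *.
  (* The path from [A] to [Gy] runs through [A * GK] and [B * Gy]: the outer steps use that [GK] and
     [B] are near 1, the middle one is [HX]. *)
  assert (Q1 : - (e1 + 2 * / K) <= A - A * GK <= e1 + 2 * / K).
  { assert (- (e1 + 2 * / K) <= 1 - GK <= e1 + 2 * / K) by lra.
    assert (0 <= A <= 1) by (unfold A; lra).
    replace (A - A * GK) with (A * (1 - GK)) by ring. nra. }
  assert (Q2 : - (4 * / K) <= B * Gy - Gy <= 0).
  { assert (- (2 * / K) <= B - 1 <= 0) by (unfold B; lra).
    assert (HGy : 0 <= Gy <= 2) by lra.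
    replace (B * Gy - Gy) with (Gy * (B - 1)) by ring.
    revert H HGy. generalize (B - 1) (/ K). clear. intros q i Hq HGy. nra. }
  unfold A in *. apply Rabs_le. lra.
Qed.

Lemma clt_order_2 y : is_lim_seq (fun n => Pn n (le_event 1 n y)) (Phi (4 * y)).
Proof.
  apply is_lim_seq_spec. intros [eps Heps]. simpl.
  (* [Rabs y] places [y] in the window, and $16/\varepsilon$ makes the tail term $8/K$ smaller than
     $\varepsilon/2$. *)
  set (K := 1 + Rabs y + 16 / eps).
  assert (HK : 1 <= K /\ Rabs y <= K /\ 16 / eps < K).
  { pose proof (Rabs_pos y). assert (0 < 16 / eps) by (apply Rdiv_lt_0_compat; lra).
    unfold K. lra. }
  destruct HK as [HK1 [HK2 HK3]]. apply Rabs_le_between in HK2.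
  assert (HC : 42 <= ratio_const K) by (unfold ratio_const; nra).
  (* This numerator of the error term also dominates every lower bound on $\sqrt n$ required by
     [clt_bound]. *)
  set (D := 400 * K + 12 * K * ratio_const K).
  assert (HKC : K <= K * ratio_const K) by nra.
  assert (HD : 0 < D) by (unfold D; lra).
  assert (HDe : 0 < D / (eps / 2)) by (apply Rdiv_lt_0_compat; lra).
  destruct (sqrt_INR_eventually (D + D / (eps / 2) + 1)) as [n0 Hn0].
  exists n0. intros n Hn. specialize (Hn0 n Hn). clear Hn.
  pose proof (sqrt_INR_sqr n) as Hsq. set (s := sqrt (INR n)) in *.
  assert (Hn2 : (2 <= n)%nat) by (apply INR_le; rewrite <- Hsq; simpl; unfold D in *; nra).
  assert (HsD : D <= s) by lra.
  assert (E : Pn n (le_event 1 n y) = psum (prune_law n) (idx n y)).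
  { rewrite Pn_le_event_1 by easy.
    destruct (idx_spec n y ltac:(fold s; lra) ltac:(fold s; unfold D in *; lra)) as [Iy Dy].
    rewrite <- (psum_cut (prune_law n) (idx n y) (S n)).
    - apply lsum_ext_in; intros m _. f_equal. f_equal.
      replace (sqrt (INR n) * (INR m / INR n - 1 / 4)) with (dev n m).
      + specialize (Iy m).
        destruct (Rle_dec (dev n m) y), (Nat.ltb_spec m (idx n y)); try easy; exfalso.
        * apply Iy in r. lia.
        * tauto.
      + unfold dev. fold s. rewrite <- Hsq. field. lra.
    - apply Nat.nlt_ge. intros H. apply Iy in H. unfold dev in H. fold s in H.
      apply Rle_div_l in H; [|lra]. rewrite S_INR in H. unfold D in *. nra. }
  rewrite E.
  pose proof (clt_bound n K y HK1) as Hb. fold s in Hb. fold D in Hb.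
  eapply Rle_lt_trans; [apply Hb; unfold D in *; lra|].
  assert (8 / K < eps / 2).
  { apply Rlt_div_l; [lra|]. apply (Rmult_lt_compat_r eps) in HK3; [|easy].
    replace (16 / eps * eps) with 16 in HK3 by (field; lra). lra. }
  assert (D / s < eps / 2).
  { apply Rlt_div_l; [lra|].
    assert (Hlt : D / (eps / 2) < s) by lra.
    apply (Rmult_lt_compat_r (eps / 2)) in Hlt; [|lra].
    replace (D / (eps / 2) * (eps / 2)) with D in Hlt by (field; lra). lra. }
  lra.
Qed.

(** * Induction on the order and the limit theorem *)

Lemma bifurcation_limit r x :
  is_lim_seq (fun n => Pn n (le_event (S r) n x)) (Phi (4 * (x / 2 ^ r))).
Proof.
  revert x. induction r as [|r IH]; intros x.
  - replace (x / 2 ^ 0) with x by (simpl; field). apply clt_order_2.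
  - apply (is_lim_seq_ext_loc (fun n =>
      psum (fun m => prune_law n m * Pn m (le_event (S r) m (x * sqrt (INR m / INR n)))) (S n))).
    { exists 2%nat. intros n Hn. symmetry. apply Pn_le_event_S; lia. }
    replace (x / 2 ^ S r) with (x / 2 / 2 ^ r).
    2:{ simpl. field. apply pow_nonzero. lra. }
    apply (mixture_limit (fun m y => Pn m (le_event (S r) m y)) (fun y => Phi (4 * (y / 2 ^ r)))).
    + intros; apply Pn_bounds.
    + intros m y z Hyz. apply Pn_monotone. intros t _. rewrite !le_event_true. lra.
    + apply IH.
    + apply (continuous_comp (fun y => 4 * (y / 2 ^ r)) Phi); [|apply continuous_Phi].
      apply (ex_derive_continuous (fun y => 4 * (y / 2 ^ r))). auto_derive. easy.
Qed.

(* Convergence in distribution to N(0, 4^(r-3)) stated via convergence of the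
   distribution functions at every point (the limit cdf is continuous). *)
Theorem theorem2 (r : nat) (Hr : (1 <= r)%nat) (x : R) :
  is_lim_seq (fun n : nat => Pn n (le_event r n x))
             (normal_cdf 0 (powerRZ 4 (Z.of_nat r - 3)) x).
Proof.
  destruct r as [|r]; [lia|].
  pose proof (pow_lt 2 r ltac:(lra)) as Hp.
  (* After the shift of [r], the standard deviation is $2^r/4$: it starts at $1/4$ and doubles with
     each pruning. *)
  replace (powerRZ 4 (Z.of_nat (S r) - 3)) with ((2 ^ r / 4) ^ 2).
  - rewrite normal_cdf_Phi by lra.
    replace (x / (2 ^ r / 4)) with (4 * (x / 2 ^ r)) by (field; lra).
    apply bifurcation_limit.
  - replace (Z.of_nat (S r) - 3)%Z with (Z.of_nat r + -2)%Z by lia.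
    rewrite powerRZ_add, <- pow_powerRZ by lra. simpl powerRZ.
    replace (4 ^ r) with (2 ^ r * 2 ^ r) by (rewrite <- Rpow_mult_distr; f_equal; ring).
    field.
Qed.
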